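(* Let $S$ be a stack polyomino, let $\lambda$ be the Ferrers shape obtained from $S$ by properly rearranging its columns, and let $k$ be a positive integer. Let $\sigma=\sigma_k(S)$ and $\tau=\sigma_k(\lambda)$ be the associated permutations. Then the difference $$\mathfrak{S}_\sigma(x_1,x_2,\ldots)-\mathfrak{S}_\tau(x_1,x_2,\ldots)$$ of Schubert polynomials is monomial positive.
   Context: Boxes are written $(\text{row},\text{column})$ with positive integer coordinates, rows numbered from top to bottom and columns from left to right. A polyomino is a finite set of boxes. It is convex if for any two boxes in it lying in the same row or column, all boxes in between are also in it; it is intersection-free if for any two columns (equivalently, rows), one is contained in the other (as sets of row, resp. column, indices). A moon polyomino is a convex, intersection-free polyomino, assumed without loss of generality to contain boxes in the first row and in the first column. A stack polyomino is a moon polyomino in which every column starts in the first row. The associated Ferrers shape $\lambda$ is obtained by rearranging the columns of $S$ in weakly decreasing order of length from left to right. A Ferrers shape (the set of boxes $(i,j)$ with $1\le j\le\lambda_i$, for $\lambda_1\ge\lambda_2\ge\cdots$) is a special moon polyomino. For a permutation $\pi\in\mathcal{S}_n$, its diagram is $\mathrm{D}(\pi)=\{(i,\pi_j): i<j,\ \pi_i>\pi_j\}$, and $r_\pi(p,q)=\#\{(i,j): i\le p,\ j\le q,\ \pi(i)=j\}$. The essential set of $\pi$ is the collection of south-east corner boxes of $\mathrm{D}(\pi)$ (boxes $(p,q)\in\mathrm{D}(\pi)$ with $(p+1,q),(p,q+1)\notin\mathrm{D}(\pi)$), each labelled by $r_\pi(p,q)$; it determines $\pi$ up to trailing fixed points.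 For a moon polyomino $M$, $\sigma_k(M)$ is the permutation with the following essential set: for each inclusion-maximal rectangle $R\subseteq M$ of width and height both strictly larger than $k$, with north-west corner box $(a+1,b+1)$ and south-east corner box $(i,j)$, take the box $(i+b,j+a)$ with label $a+b+k$. A pipe dream of size $n$ is a filling of the boxes of the staircase shape $(n-1,\ldots,2,1)$, each with either two crossing pipes or two turning pipes (one turning piece joining the left and top sides, the other joining the bottom and right sides); along the antidiagonal just outside the staircase, pipes turn from the top side to the left side. Its permutation is obtained by labelling the pipes $1,\ldots,n$ along the top from left to right, following them to the left side, and reading the labels there from top to bottom in one-line notation. It is reduced if any two pipes cross at most once. A pipe dream is identified with its set of crossing boxes. $\mathfrak{S}_\pi$ denotes the Schubert polynomial of Lascoux and Schützenberger; equivalently, $\mathfrak{S}_\pi=\sum_D\prod_{(i,j)\in D}x_i$, summed over all reduced pipe dreams $D$ with permutation $\pi$. A polynomial is monomial positive if all its coefficients in the monomial expansion are nonnegative. *)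

(* Defs.v *)
From HB Require Import structures.
From mathcomp Require Import all_boot all_order all_algebra all_fingroup.
From mathcomp Require Import finmap monalg.

Set Implicit Arguments.
Unset Strict Implicit.
Unset Printing Implicit Defensive.

Import Order.TTheory GRing.Theory Num.Theory.

Local Open Scope fset_scope.
Local Open Scope nat_scope.

(* Rows, columns and the letters of permutations are numbered from 0: the box *)
(* in row i and column j (i, j >= 1) is (i.-1, j.-1).                         *)
Notation box := (nat * nat)%type.

(* ---- Polyominoes --------------------------------------------------------- *)

Definition convex (M : {fset box}) : Prop :=
  (forall r c1 c c2, c1 <= c <= c2 ->
     (r, c1) \in M -> (r, c2) \in M -> (r, c) \in M) /\
  (forall c r1 r r2, r1 <= r <= r2 ->
     (r1, c) \in M -> (r2, c) \in M -> (r, c) \in M).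

Definition intersection_free (M : {fset box}) : Prop :=
  forall c1 c2,
    (forall r, (r, c1) \in M -> (r, c2) \in M) \/
    (forall r, (r, c2) \in M -> (r, c1) \in M).

Definition is_moon (M : {fset box}) : Prop :=
  [/\ convex M, intersection_free M,
      exists c : nat, (0, c) \in M & exists r : nat, (r, 0) \in M].

Definition is_stack (S : {fset box}) : Prop :=
  is_moon S /\ forall r c, (r, c) \in S -> (0, c) \in S.

Definition col_length (M : {fset box}) (c : nat) : nat :=
  #|` [fset x in M | x.2 == c] |.

Definition sorted_col_lengths (M : {fset box}) : seq nat :=
  sort geq [seq col_length M c | c <- [fset x.2 | x in M]].

(* The Ferrers shape whose columns, from left to right, are the columns of S  *)
(* in weakly decreasing order of length, each starting in the first row.      *)
Definition ferrers_of (S : {fset box}) : {fset box} :=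
  let s := sorted_col_lengths S in
  [fset ((i, j) : box) | j in iota 0 (size s), i in iota 0 (nth 0 s j)].

Definition rectangle (nw se : box) : {fset box} :=
  [fset ((r, c) : box) | r in iota nw.1 (se.1.+1 - nw.1),
                 c in iota nw.2 (se.2.+1 - nw.2)].

Definition maximal_rectangle (M : {fset box}) (nw se : box) : Prop :=
  [/\ nw.1 <= se.1, nw.2 <= se.2, rectangle nw se `<=` M &
      forall nw' se', rectangle nw se `<=` rectangle nw' se' ->
        rectangle nw' se' `<=` M -> rectangle nw' se' = rectangle nw se].

(* ---- Permutations and essential sets ------------------------------------- *)

Definition diagram n (pi : 'S_n) : {fset box} :=
  [fset ((nat_of_ord x.1, nat_of_ord (pi x.2)) : box) | x in
     [pred x : 'I_n * 'I_n | (x.1 < x.2) && (pi x.2 < pi x.1)]].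

Definition rank_fun n (pi : 'S_n) (p q : nat) : nat :=
  #|[set i : 'I_n | (i <= p) && (pi i <= q)]|.

Definition essential n (pi : 'S_n) (x : box) (l : nat) : Prop :=
  [/\ x \in diagram pi, (x.1.+1, x.2) \notin diagram pi,
      (x.1, x.2.+1) \notin diagram pi & l = rank_fun pi x.1 x.2].

(* pi is sigma_k(M).  The essential set determines pi only up to trailing     *)
(* fixed points, so the size n is left free.  With 0-based coordinates the    *)
(* maximal rectangle has corners (a, b) and (i, j), height i + 1 - a and      *)
(* width j + 1 - b.                                                           *)
Definition is_sigma (k : nat) (M : {fset box}) n (pi : 'S_n) : Prop :=
  forall (x : box) (l : nat),
    essential pi x l <->
    exists a b i j, [/\ maximal_rectangle M (a, b) (i, j),
      k < i.+1 - a, k < j.+1 - b, x = (i + b, j + a) & l = a + b + k].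

(* ---- Pipe dreams and Schubert polynomials -------------------------------- *)

Definition staircase (n : nat) : {fset box} :=
  [fset ((i, j) : box) | i in iota 0 n, j in iota 0 (n.-1 - i)].

(* Position of a pipe followed from the top to the left side: (d, r, c.+1)    *)
(* means that it enters box (r, c) through its top side if d is true, and     *)
(* through its right side if d is false; (d, r, 0) means that it has left     *)
(* through the left side of row r.  At a crossing box the pipe keeps its      *)
(* direction, elsewhere it turns (top to left, or right to bottom).           *)
Definition pipe_step (D : {fset box}) (s : bool * nat * nat) :
    bool * nat * nat :=
  let: (d, r, c) := s in
  if c is c'.+1 then
    if ((r, c') \in D) == d then (true, r.+1, c) else (false, r, c')
  else s.

(* Every pipe of a pipe dream of size n reaches the left side in fewer than   *)
(* 2 * n steps.                                                               *)
Definition pipe (n : nat) (D : {fset box}) (p : nat) : seq (bool * nat * nat) :=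
  traject (pipe_step D) (true, 0, p.+1) (2 * n).

Definition exit_row (n : nat) (D : {fset box}) (p : nat) : nat :=
  (iter (2 * n) (pipe_step D) (true, 0, p.+1)).1.2.

(* Read from top to bottom, the labels on the left side are pi 0, pi 1, ...   *)
Definition has_perm n (D : {fset box}) (pi : 'S_n) : bool :=
  [forall r : 'I_n, exit_row n D (pi r) == r].

Definition cross_at (n : nat) (D : {fset box}) (p q : nat) (x : box) : bool :=
  ((true, x.1, x.2.+1) \in pipe n D p) && ((false, x.1, x.2.+1) \in pipe n D q)
  || ((true, x.1, x.2.+1) \in pipe n D q) &&
     ((false, x.1, x.2.+1) \in pipe n D p).

Definition reduced (n : nat) (D : {fset box}) : bool :=
  [forall p : 'I_n, forall q : 'I_n,
     (p != q) ==> (#|` [fset x in D | cross_at n D p q x] | <= 1)].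

(* Polynomials with integer coefficients in infinitely many variables; xvar i *)
(* is the variable attached to row i.                                         *)
Notation ipoly := {malg int[{cmonom nat}]}.

Definition xvar (i : nat) : ipoly := (<< ucm i >>)%R.

Definition schubert n (pi : 'S_n) : ipoly :=
  (\sum_(D <- fpowerset (staircase n) | reduced n D && has_perm D pi)
     \prod_(x <- D) xvar x.1)%R.

Definition monomial_positive (f : ipoly) : Prop :=
  forall m : {cmonom nat}, (0 <= f@_m)%R.

(* Main.v *)
(* Both sigma and tau are vexillary, with the same shape: the rows t of the    *)
(* shape have lengths W(t+k) - k, where W is the row width of S (equivalently *)
(* of lambda). The flags differ: t+k+B(t+k) for sigma and t+k for tau, where  *)
(* B(r) is the first column of S in row r. A vexillary Schubert polynomial is *)
(* the flagged Schur determinant det (h_{mu_i - i + j}(x_0, .., x_{phi_i})),  *)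
(* which is monotone in the flag: since                                       *)
(*   h_m(x_0, .., x_f) = h_m(x_0, .., x_{f-1}) + x_f h_{m-1}(x_0, .., x_f),   *)
(* lowering a flag by one subtracts x_f times another such determinant.       *)
(* The determinantal formula is obtained from the longest permutation by      *)
(* divided differences: the sum over reduced pipe dreams satisfies the        *)
(* divided difference recursion by the Fomin-Kirillov argument in the         *)
(* nilCoxeter algebra. The shape and the flag are read off the Lehmer code,   *)
(* which is W(t+k) - k at position t+k+B(t+k) and zero elsewhere.             *)
Require Import Defs.
From mathcomp Require Import all_boot all_order all_algebra all_fingroup.
From mathcomp Require Import finmap monalg.
From mathcomp Require Import zify ring.

Set Implicit Arguments.
Unset Strict Implicit.
Unset Printing Implicit Defensive.

Import Order.TTheory GRing.Theory Num.Theory.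

Local Open Scope fset_scope.
Local Open Scope nat_scope.

(** * The Fomin-Kirillov identities *)

(** Row [r] of a stack is an interval of [W r] boxes starting in column [B r]. These intervals
    shrink from top to bottom, and rearranging the columns keeps [W] and makes [B] zero
    ([stack_rows], [ferrers_rows]). A maximal rectangle starts in the first row and is determined by
    its bottom row, so the essential set is explicit. It forces the Lehmer codes of sigma and tau to
    have the same nonzero entries in the same order, those of sigma at the same or later positions
    ([sigma_flag_code]). The Schubert polynomial of such a code is a determinant whose flag is given
    by these positions ([word_sum_flag]). Both polynomials are thus one determinant at two
    comparable flags, and [flag_det_sub_pos] gives positivity of the difference.

    In [word_sum_flag] both sides obey the same divided difference recursion ([word_sum_divdiff],
    [flag_det_divdiff]): an entry of the code moves one position left into a free place and grows by
    one. When no entry can move, the code is weakly decreasing and both sides are the monomial with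
    the code as exponents ([word_sum_dominant], [flag_det_dominant]). Factors [x i - x j] are
    cancelled, never divided by ([generic_xvar]). Pipe dreams enter through [pipe_dream_run]:
    reading the crossings row by row, each row from right to left, gives a word in adjacent swaps,
    and the reduced pipe dreams of a permutation are its reduced words inside the staircase. *)

Section FominKirillov.

Local Open Scope ring_scope.

(** Used with [p = y * u i], [q = z * u i.+1], [s = z * u i]: the right side is then symmetric in
    [y] and [z], which is an additive form of the Yang-Baxter equation. *)
Lemma yang_baxter_factor (A : pzRingType) (p q s : A) :
  p * s = 0 -> q * q = 0 -> p * q * s = q * p * q ->
  (1 - q) * ((1 + p) * (1 + q) * (1 + s)) = 1 + p + s + (p * q - q * p).
Proof.
move=> ps qq pqs.
have e1 : (1 + p) * (1 + q) * (1 + s) = 1 + p + s + p * q + q * p * q + (q + q * s).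
  rewrite -mulrA [(1 + q) * _]mulrDl mul1r mulrDl mul1r.
  rewrite [q * (1 + s)]mulrDr mulr1 !mulrDr mulr1 ps addr0 !mulrA pqs.
  by rewrite !addrA (ACl (1*5*2*6*7*3*4)%AC) /=.
rewrite mulrBl mul1r e1.
have -> : q * (1 + p + s + p * q + q * p * q + (q + q * s))
   = q * p + q * p * q + (q + q * s).
  rewrite !mulrDr mulr1 !mulrA qq !mul0r !addr0.
  by rewrite (ACl ((2*4)*(1*3))%AC).
rewrite opprD addrACA subrr addr0 opprD.
by rewrite addrACA subrr addr0 addrA.
Qed.

Variables (A : pzRingType) (u : nat -> A).
Hypothesis usq : forall i, u i * u i = 0.
Hypothesis ubraid : forall i, u i * u i.+1 * u i = u i.+1 * u i * u i.+1.
Hypothesis ucomm : forall i j, (i.+1 < j)%N -> u i * u j = u j * u i.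

Definition hterm (y : A) i : A := 1 + y * u i.

(** Generators occur in decreasing order because a row of a pipe dream is read from right to
    left. *)
Definition hrow (y : A) r m : A := \prod_(l <- rev (iota r m)) hterm y l.

Lemma hrowS y r m : hrow y r m.+1 = hrow y r.+1 m * hterm y r.
Proof. by rewrite /hrow /= rev_cons big_rcons /= /hterm. Qed.

Definition central (y : A) := forall a, y * a = a * y.

Lemma hrow_gen_comm z i r m : central z -> (i.+1 < r)%N ->
  GRing.comm (hrow z r m) (u i).
Proof.
move=> cz; elim: m r => [|m IH] r ir.
  by rewrite /hrow big_nil; apply: commr_sym; apply: commr1.
rewrite hrowS; apply: commr_sym; apply: commrM; apply: commr_sym.
  by apply: IH; apply: ltnW.
apply: commr_sym; apply: commrD; first exact: commr1.
apply: commrM; first by apply: commr_sym; apply: cz.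
exact: ucomm.
Qed.

Lemma hrow_comm y z i r m : central y -> central z -> (i.+1 < r)%N ->
  GRing.comm (hrow z r m) (hterm y i).
Proof.
move=> cy cz ir; apply: commrD; first exact: commr1.
apply: commrM; last exact: hrow_gen_comm.
by apply: commr_sym; apply: cy.
Qed.

Lemma htermNK z i : central z -> hterm z i * hterm (- z) i = 1.
Proof.
move=> cz; rewrite /hterm mulNr mulrDl mul1r mulrBr mulr1.
by rewrite -!mulrA (mulrA (u i)) -cz -mulrA usq !mulr0 subr0 subrK.
Qed.

Lemma scaled_sq y z i : central z -> (y * u i) * (z * u i) = 0.
Proof. by move=> cz; rewrite -mulrA (mulrA (u i)) -cz -mulrA usq !mulr0. Qed.

Lemma hterm_same_comm y z i : central y -> central z ->
  GRing.comm (hterm y i) (hterm z i).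
Proof.
move=> cy cz; apply: commrD; first exact: commr1.
apply: commr_sym; apply: commrD; first exact: commr1.
by rewrite /GRing.comm !scaled_sq.
Qed.

Lemma scaled_pair y z i j : central y -> central z ->
  (y * u i) * (z * u j) = (y * z) * (u i * u j).
Proof. by move=> cy cz; rewrite -mulrA (mulrA (u i)) -cz !mulrA. Qed.

Lemma scaled_triple y z t i j k : central y -> central z -> central t ->
  (y * u i) * (z * u j) * (t * u k) = (y * z * t) * (u i * u j * u k).
Proof.
move=> cy cz ct; rewrite scaled_pair //.
by rewrite mulrA -(mulrA (y * z)) -ct !mulrA.
Qed.

Lemma hterm_exchange y z i : central y -> central z ->
  hterm (- z) i.+1 * (hterm y i * hterm z i.+1 * hterm z i) =
  hterm (- y) i.+1 * (hterm z i * hterm y i.+1 * hterm y i).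
Proof.
move=> cy cz; rewrite /hterm !mulNr.
rewrite !yang_baxter_factor ?scaled_sq //.
- by rewrite !scaled_pair // (cz y) (addrAC 1).
- by rewrite !scaled_triple // ubraid (cz y).
- by rewrite !scaled_triple // ubraid (cy z).
Qed.

(** The term of index [r] of the first row commutes with all terms of the second row except those of
    index [r] and [r.+1]. Inserting the inverse of the latter splits off the product of the shorter
    rows, and what remains is symmetric by [hterm_exchange]. *)
Lemma hrow_symm m r y z : central y -> central z ->
  hrow y r m * hrow z r m = hrow z r m * hrow y r m.
Proof.
move=> cy cz; elim: m r => [|m IH] r; first by rewrite /hrow !big_nil.
case: m => [|m] in IH *.
  by rewrite !hrowS /hrow !big_nil !mul1r; apply: hterm_same_comm.
have key y' z' : central y' -> central z' ->
  hrow y' r m.+2 * hrow z' r m.+2 =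
  hrow y' r.+1 m.+1 * hrow z' r.+1 m.+1 *
  (hterm (- z') r.+1 * (hterm y' r * hterm z' r.+1 * hterm z' r)).
  move=> cy' cz'; rewrite !(hrowS _ r) [hrow z' r.+1 m.+1]hrowS.
  rewrite -!mulrA; congr (_ * _); rewrite !mulrA.
  rewrite -(hrow_comm _ cy' cz') //.
  by rewrite -(mulrA _ (hterm z' r.+1) (hterm (- z') r.+1)) htermNK // mulr1.
by rewrite (key y z) // (key z y) // (IH r.+1) // hterm_exchange.
Qed.

(** Both products on the left are the symmetric product of [hrow_symm] times [1 - z * u r] or
    [1 - y * u r]; this factor disappears in front of [u r], whose square is zero. *)
Lemma hrow_divdiff m r y z : central y -> central z ->
  hrow y r m.+1 * hrow z r.+1 m - hrow z r m.+1 * hrow y r.+1 m =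
  (y - z) * (hrow y r m.+1 * hrow z r.+1 m * u r).
Proof.
move=> cy cz.
have key y' z' : central y' -> central z' -> hrow y' r m.+1 * hrow z' r.+1 m =
    hrow y' r m.+1 * hrow z' r m.+1 * (1 - z' * u r).
  move=> cy' cz'; rewrite (hrowS z') -!mulrA.
  by have := htermNK r cz'; rewrite {2}/hterm mulNr => ->; rewrite mulr1.
have kz : hrow z r m.+1 * hrow y r.+1 m = 
    hrow y r m.+1 * hrow z r m.+1 * (1 - y * u r).
  by rewrite key // (hrow_symm _ _ cz).
have -> : hrow y r m.+1 * hrow z r.+1 m * u r = hrow y r m.+1 * hrow z r m.+1 * u r.
  rewrite key // -!mulrA; congr (_ * (_ * _)).
  by rewrite mulrBl mul1r -mulrA usq mulr0 subr0.
rewrite key // kz -mulrBr opprB addrCA [1 - _]addrC addrK -mulrBl.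
rewrite (_ : (y - z) * u r = u r * (y - z)); last first.
  by rewrite mulrBl mulrBr cy cz.
have cyz : central (y - z) by move=> a; rewrite mulrBl mulrBr cy cz.
by rewrite mulrA -cyz.
Qed.

End FominKirillov.

(** * The nilCoxeter algebra acting on permutations *)

Definition val_at n (w : 'S_n) (i : nat) : nat :=
  if insub i is Some a then val (w a) else i.

(** In a product of permutations the left factor acts first, so [adj_swap n i * w] exchanges the
    entries of [w] at positions [i] and [i.+1]. *)
Definition adj_swap n (i : nat) : 'S_n :=
  if (insub i, insub i.+1) is (Some a, Some b) then tperm a b else 1%g.

Definition swap_nat (i j : nat) : nat :=
  if j == i then i.+1 else if j == i.+1 then i else j.

Definition asc n (w : 'S_n) (i : nat) : bool :=
  (i.+1 < n) && (val_at w i < val_at w i.+1).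

Lemma val_at_ord n (w : 'S_n) (a : 'I_n) : val_at w a = w a.
Proof. by rewrite /val_at valK. Qed.

Lemma val_at_out n (w : 'S_n) i : n <= i -> val_at w i = i.
Proof. by move=> ni; rewrite /val_at insubF // ltnNge ni. Qed.

Lemma val_at_lt n (w : 'S_n) i : (val_at w i < n) = (i < n).
Proof.
case: (ltnP i n) => [i_n|n_i]; last by rewrite val_at_out // ltnNge n_i.
by rewrite (val_at_ord w (Ordinal i_n)) ltn_ord.
Qed.

Lemma val_at_inj n (w : 'S_n) : injective (val_at w).
Proof.
move=> i j e.
have := val_at_lt w i; rewrite e val_at_lt => eij.
case: (ltnP i n) eij => [i_n|n_i] j_n; last first.
  have n_j : n <= j by rewrite leqNgt j_n.
  by move: e; rewrite !val_at_out.
move: e; rewrite (val_at_ord w (Ordinal i_n)) (val_at_ord w (Ordinal j_n)).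
by move/val_inj/perm_inj/(congr1 val).
Qed.

Lemma val_atP n (w w' : 'S_n) :
  (forall i, i < n -> val_at w i = val_at w' i) -> w = w'.
Proof.
by move=> e; apply/permP => a; apply/val_inj; rewrite /= -!val_at_ord e.
Qed.

Lemma val_at_swap n (w : 'S_n) i j : i.+1 < n ->
  val_at (adj_swap n i * w)%g j = val_at w (swap_nat i j).
Proof.
move=> i1n; have i_n := ltnW i1n.
rewrite /adj_swap (insubT (fun m => m < n) i_n) (insubT (fun m => m < n) i1n) /=.
case: (ltnP j n) => [j_n|n_j]; last first.
  rewrite val_at_out // /swap_nat.
  by case: eqP => [|_]; [lia | case: eqP => [|_]; [lia | rewrite val_at_out]].
rewrite (val_at_ord _ (Ordinal j_n)) permM -val_at_ord; congr val_at.
rewrite /swap_nat; case: tpermP => /=.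
- by move=> [->]; rewrite eqxx.
- by move=> [->]; rewrite eqxx; case: eqP => //; lia.
move=> /eqP ni /eqP nSi; move: ni nSi; rewrite -!val_eqE /=.
by move=> /negbTE -> /negbTE ->.
Qed.

Lemma swap_natK i : involutive (swap_nat i).
Proof. by move=> j; rewrite /swap_nat; do !case: eqP => //; lia. Qed.

Lemma adj_swapK n i (w : 'S_n) : (adj_swap n i * (adj_swap n i * w) = w)%g.
Proof.
rewrite mulgA /adj_swap; case: (insub i) => [a|]; last by rewrite !mul1g.
case: (insub i.+1) => [b|]; last by rewrite !mul1g.
by rewrite tperm2 mul1g.
Qed.

Lemma asc_swap n (w : 'S_n) i : i.+1 < n ->
  asc (adj_swap n i * w)%g i = ~~ asc w i.
Proof.
move=> i1n; rewrite /asc i1n /= !val_at_swap // /swap_nat eqxx.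
have -> : (i.+1 == i) = false by apply/eqP; lia.
rewrite eqxx.
by case: (ltngtP (val_at w i) (val_at w i.+1)) => // /val_at_inj; lia.
Qed.

Section NilCoxeter.

Variables (R : comNzRingType) (n : nat).
Notation N := #|{: 'S_n}|.
Local Open Scope ring_scope.

Definition perm_row (w : 'S_n) : 'rV[R]_N := delta_mx 0 (enum_rank w).

(** A nilCoxeter generator in the regular representation, acting on row vectors from the right, so
    that products are read in the order of the word. *)
Definition nil_gen (i : nat) : 'M[R]_N :=
  \matrix_(p, q) ((asc (enum_val p) i) &&
                  (enum_val q == adj_swap n i * enum_val p)%g)%:R.

Lemma perm_row_gen w i :
  perm_row w *m nil_gen i =
  if asc w i then perm_row (adj_swap n i * w)%g else 0.
Proof.
apply/rowP => q; rewrite -rowE !mxE enum_rankK.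
case: ifP => _ /=; last by rewrite mxE.
by rewrite mxE eqxx /= -(inj_eq enum_rank_inj) enum_valK.
Qed.

Lemma perm_row_ext (A B : 'M[R]_N) :
  (forall w, perm_row w *m A = perm_row w *m B) -> A = B.
Proof.
move=> e; apply/row_matrixP => i; rewrite !rowE -[i]enum_valK; exact: e.
Qed.

Lemma nil_gen_sq i : nil_gen i * nil_gen i = 0.
Proof.
apply: perm_row_ext => w; rewrite mulmx0 mulmxA perm_row_gen.
case: ifP => [a|_]; last by rewrite mul0mx.
by rewrite perm_row_gen asc_swap ?a //; case/andP: a.
Qed.

Lemma perm_row_gen2 w i j :
  perm_row w *m (nil_gen i * nil_gen j) =
  if asc w i && asc (adj_swap n i * w)%g j
  then perm_row (adj_swap n j * (adj_swap n i * w))%g else 0.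
Proof.
rewrite mulmxA perm_row_gen; case: (asc w i) => /=; last by rewrite mul0mx.
by rewrite perm_row_gen.
Qed.

Lemma perm_row_gen3 w i j k :
  perm_row w *m (nil_gen i * nil_gen j * nil_gen k) =
  if [&& asc w i, asc (adj_swap n i * w)%g j &
         asc (adj_swap n j * (adj_swap n i * w))%g k]
  then perm_row (adj_swap n k * (adj_swap n j * (adj_swap n i * w)))%g else 0.
Proof.
rewrite mulmxA perm_row_gen2 andbA; case: ifP => _ /=; last by rewrite mul0mx.
by rewrite perm_row_gen.
Qed.

Lemma nil_gen_comm i j : (i.+1 < j)%N ->
  nil_gen i * nil_gen j = nil_gen j * nil_gen i.
Proof.
move=> ij; apply: perm_row_ext => w; rewrite !perm_row_gen2.
case: (ltnP j.+1 n) => jn; last first.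
  by rewrite /asc !(ltnNge j.+1) jn /= andbF.
have i1n : (i.+1 < n)%N by lia.
have -> : asc (adj_swap n i * w)%g j = asc w j.
  by rewrite /asc !val_at_swap // /swap_nat; do !case: eqP => //; lia.
have -> : asc (adj_swap n j * w)%g i = asc w i.
  by rewrite /asc !val_at_swap // /swap_nat; do !case: eqP => //; lia.
rewrite andbC; case: ifP => // _; congr perm_row; apply: val_atP => k _.
rewrite !val_at_swap //; congr val_at; rewrite /swap_nat.
by do !case: eqP; lia.
Qed.

(** Both sides reverse three consecutive entries of [w] provided that these increase; the three
    ascent tests are the same comparisons in opposite orders. *)
Lemma nil_gen_braid i :
  nil_gen i * nil_gen i.+1 * nil_gen i = nil_gen i.+1 * nil_gen i * nil_gen i.+1.
Proof.
apply: perm_row_ext => w; rewrite !perm_row_gen3.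
case: (ltnP i.+2 n) => i2n; last first.
  by rewrite /asc !(ltnNge i.+2) i2n /= !andbF.
have i1n : (i.+1 < n)%N by lia.
have [s1 s2 s3] : [/\ swap_nat i i = i.+1, swap_nat i i.+1 = i &
    swap_nat i i.+2 = i.+2].
  by rewrite /swap_nat; split; do !case: eqP; lia.
have [s4 s5 s6] : [/\ swap_nat i.+1 i = i, swap_nat i.+1 i.+1 = i.+2 &
    swap_nat i.+1 i.+2 = i.+1].
  by rewrite /swap_nat; split; do !case: eqP; lia.
rewrite /asc i1n i2n /= !val_at_swap // !(s1, s2, s3, s4, s5, s6).
have and3_rev x y z : [&& x, y & z] = [&& z, y & x] by case: x y z => [] [] [].
rewrite [in RHS]and3_rev; case: ifP => // _; congr perm_row; apply: val_atP => k _.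
rewrite !val_at_swap //; congr val_at; rewrite /swap_nat.
by do !case: eqP; lia.
Qed.

End NilCoxeter.

(** * Flagged Schur determinants *)

Section CompleteSymmetric.

Local Open Scope ring_scope.

Variable R : comNzRingType.
Implicit Types x : nat -> R.

(** The complete symmetric polynomial of degree [m] in the first [f] variables. The recursion lowers
    either the number of variables or the degree, hence the nested fixpoint. *)
Fixpoint csym x (f m : nat) : R :=
  if f is f'.+1 then
    (fix csym_rec m := if m is m'.+1 then csym x f' m + x f' * csym_rec m' else 1) m
  else (m == 0%N)%:R.

Lemma csym_m0 x f : csym x f 0 = 1.
Proof. by case: f. Qed.

Lemma csymS x f m : csym x f.+1 m.+1 = csym x f m.+1 + x f * csym x f.+1 m.
Proof. by []. Qed.

Lemma eq_csym x y f m : (forall i, (i < f)%N -> x i = y i) -> csym x f m = csym y f m.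
Proof.
elim: f m => [//|f IH] m e; elim: m => [|m IHm]; first by rewrite !csym_m0.
by rewrite !csymS IHm e // IH // => i i_f; apply: e; apply: ltnW.
Qed.

Definition swap_vars (i : nat) x : nat -> R := fun j => x (swap_nat i j).

Lemma csym_swap_small x i f m : (f <= i)%N -> csym (swap_vars i x) f m = csym x f m.
Proof.
move=> fi; apply: eq_csym => j jf.
by rewrite /swap_vars /swap_nat; do !case: eqP => //; lia.
Qed.

Lemma swap_vars_at x i :
  (swap_vars i x i = x i.+1) * (swap_vars i x i.+1 = x i).
Proof. by rewrite /swap_vars /swap_nat; split; do !case: eqP => //; lia. Qed.

(** A divided difference of a complete symmetric polynomial gains a variable and loses a degree;
    clearing the denominator makes this meaningful over any commutative ring. *)
Lemma csym_divdiff x f m :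
  csym x f.+1 m.+1 = csym (swap_vars f x) f.+1 m.+1 + (x f - x f.+1) * csym x f.+2 m.
Proof.
elim: m => [|m IH]; rewrite csymS [in RHS]csymS ?csym_m0 csym_swap_small // swap_vars_at.
  by ring.
by rewrite [in RHS](csymS x f.+1) IH; ring.
Qed.

Lemma csym_swap_large x i f m : (i.+1 < f)%N -> csym (swap_vars i x) f m = csym x f m.
Proof.
elim: f m => [//|f IH] m; rewrite ltnS leq_eqVlt => /orP[/eqP e|lt].
  rewrite -e {f IH e}; elim: m => [|m IHm]; first by rewrite !csym_m0.
  by rewrite csymS IHm [RHS]csymS (csym_divdiff x) swap_vars_at; ring.
elim: m => [|m IHm]; first by rewrite !csym_m0.
rewrite !csymS IHm IH // /swap_vars /swap_nat; do !case: eqP => //; lia.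
Qed.

Lemma csym_drop_first x f m :
  csym x f.+1 m.+1 = x 0%N * csym x f.+1 m + csym (x \o succn) f m.+1.
Proof.
elim: f m => [|f IH] m; first by rewrite csymS /= add0r addr0.
elim: m => [|m IHm]; rewrite csymS IH (csymS (x \o succn)) -[(x \o succn) f]/(x f.+1).
  by rewrite !csym_m0; ring.
by rewrite [in LHS]IHm (csymS x f.+1); ring.
Qed.

(** Degree [a - b], with value 0 in negative degree, where truncated subtraction alone would give
    1. *)
Definition csym_shift x (f a b : nat) : R :=
  if (b <= a)%N then csym x f (a - b) else 0.

Lemma csym_shiftS x f a b :
  csym_shift x f.+1 a.+1 b = csym_shift x f a.+1 b + x f * csym_shift x f.+1 a b.
Proof.
rewrite /csym_shift; case: (ltngtP b a.+1) => [ba|ab|->].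
- by rewrite -ltnS ba subSn // csymS.
- by rewrite ifF; [ring | lia].
- by rewrite subnn !csym_m0 ltnn; ring.
Qed.

Lemma csym_shift0 x f b : csym_shift x f.+1 0 b = csym_shift x f 0 b.
Proof. by rewrite /csym_shift; case: b => [|b] //=; rewrite !csym_m0. Qed.

Lemma csym_shift_divdiff x f a b :
  csym_shift x f.+1 a.+1 b =
  csym_shift (swap_vars f x) f.+1 a.+1 b + (x f - x f.+1) * csym_shift x f.+2 a b.
Proof.
rewrite /csym_shift; case: (ltngtP b a.+1) => [ba|ab|->].
- by rewrite -ltnS ba subSn // csym_divdiff.
- by rewrite ifF; [ring | lia].
- by rewrite subnn !csym_m0 ltnn; ring.
Qed.

Lemma csym_shift_drop_first x f a b :
  csym_shift x f.+1 a b = x 0%N * csym_shift x f.+1 a b.+1 + csym_shift (x \o succn) f a b.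
Proof.
rewrite /csym_shift; case: (ltngtP b a) => [ba|ab|->].
- by rewrite -[(a - b)%N]prednK ?subn_gt0 // csym_drop_first subnS.
- by ring.
- by rewrite subnn !csym_m0; ring.
Qed.

End CompleteSymmetric.

Definition upd (f : nat -> nat) (t v : nat) : nat -> nat :=
  fun i => if i == t then v else f i.

Lemma sum_upd (L t v : nat) (f : nat -> nat) : (t < L)%N -> f t = v.+1 ->
  (\sum_(i < L) f i = (\sum_(i < L) upd f t v i).+1)%N.
Proof.
move=> tL ft; rewrite (bigD1 (Ordinal tL)) // [in RHS](bigD1 (Ordinal tL)) //=.
rewrite ft {1}/upd eqxx addSn; congr (_ + _).+1; apply: eq_bigr => i it.
by rewrite /upd ifN.
Qed.

Section FlagDeterminant.

Local Open Scope ring_scope.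

Variable R : comNzRingType.
Implicit Types (x : nat -> R) (a f : nat -> nat).

(** For [a i = mu i + (L - i.+1)] the entry has degree [mu i - i + j], as in the Jacobi-Trudi
    matrix; [a] decreases strictly exactly when [mu] decreases weakly. *)
Definition flag_mx x L a f : 'M[R]_L :=
  \matrix_(i, j) csym_shift x (f i) (a i) (L - j.+1).

Definition flag_det x L a f : R := \det (flag_mx x L a f).

Lemma eq_flag_det x L a a' f f' :
  (forall i, (i < L)%N -> a i = a' i) -> (forall i, (i < L)%N -> f i = f' i) ->
  flag_det x L a f = flag_det x L a' f'.
Proof.
by move=> ea ef; congr (\det _); apply/matrixP => i j; rewrite !mxE ea ?ef.
Qed.

Lemma det_row_split L (t : 'I_L) (A B C : 'M[R]_L) (c : R) :
  (forall i j, i != t -> A i j = B i j) -> (forall i j, i != t -> A i j = C i j) ->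
  (forall j, A t j = B t j + c * C t j) -> \det A = \det B + c * \det C.
Proof.
move=> eB eC et; rewrite (@determinant_multilinear _ _ A B C t 1 c) ?mul1r //.
- by apply/rowP => j; rewrite !mxE mul1r.
- by apply/matrixP => i j; rewrite !mxE eB // eq_sym neq_lift.
- by apply/matrixP => i j; rewrite !mxE eC // eq_sym neq_lift.
Qed.

Lemma flag_det_split x L a f t u v : (t < L)%N -> a t = u.+1 -> f t = v.+1 ->
  flag_det x L a f = flag_det x L a (upd f t v) + x v * flag_det x L (upd a t u) f.
Proof.
move=> tL at_ ft; apply: (@det_row_split _ (Ordinal tL)) => [i j it|i j it|j].
- by rewrite !mxE /upd ifN.
- by rewrite !mxE /upd ifN.
- by rewrite !mxE /= /upd eqxx at_ ft csym_shiftS.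
Qed.

Lemma flag_det_split0 x L a f t v : (t < L)%N -> a t = 0%N -> f t = v.+1 ->
  flag_det x L a f = flag_det x L a (upd f t v).
Proof.
move=> tL at_ ft; congr (\det _); apply/matrixP => i j; rewrite !mxE /upd.
by case: eqP => // ->; rewrite at_ ft csym_shift0.
Qed.

(** Rows other than [t] contain both or neither of the variables [i] and [i.+1] and are symmetric in
    them, so the divided difference acts on row [t] alone. *)
Lemma flag_det_divdiff x L a f t u i : (t < L)%N -> a t = u.+1 -> f t = i.+1 ->
  (forall j, (j < L)%N -> j != t -> f j != i.+1) ->
  flag_det x L a f - flag_det (swap_vars i x) L a f =
  (x i - x i.+1) * flag_det x L (upd a t u) (upd f t i.+2).
Proof.
move=> tL at_ ft fj; apply/eqP; rewrite subr_eq addrC; apply/eqP.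
apply: (@det_row_split _ (Ordinal tL)) => [k j kt|k j kt|j].
- rewrite !mxE /csym_shift; case: ifP => // _.
  have := fj k (ltn_ord k) kt; case: (ltngtP (f k) i.+1) => // fk _.
    by rewrite csym_swap_small.
  by rewrite csym_swap_large.
- by rewrite !mxE /upd !ifN.
- by rewrite !mxE /= /upd eqxx at_ ft csym_shift_divdiff.
Qed.

Lemma flag_det_dup x L a f t : (t.+1 < L)%N -> a t = a t.+1 -> f t = f t.+1 ->
  flag_det x L a f = 0.
Proof.
move=> tL ea ef; apply: (@determinant_alternate _ _ _ (Ordinal (ltnW tL)) (Ordinal tL)).
  by rewrite -val_eqE /= neq_ltn ltnSn.
by move=> j; rewrite !mxE /= ea ef.
Qed.

(** * Monotonicity of the determinant in its flag *)

Section Positivity.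

Variables (x : nat -> R) (P : R -> Prop).
Hypotheses (P0 : P 0) (P1 : P 1) (PD : forall y z, P y -> P z -> P (y + z)).
Hypothesis PX : forall i y, P y -> P (x i * y).

(** Without variables an entry is 1 in degree zero and 0 otherwise. If [a 0 < L], strict decrease
    forces [a i = L - i.+1] and the matrix is the identity; if not, its first row vanishes. *)
Lemma flag_det_empty_flag_pos L a f : (forall i, (i < L)%N -> f i = 0%N) ->
  (forall i, (i.+1 < L)%N -> (a i.+1 < a i)%N) -> P (flag_det x L a f).
Proof.
move=> f0 sa; case: (posnP L) => [L0|L0].
  by rewrite /flag_det; move: (flag_mx _ _ _ _); rewrite L0 => M; rewrite det_mx00.
case: (ltnP (a 0%N) L) => [a0|La].
  have up i : (i < L)%N -> (a i + i < L)%N.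
    by elim: i => [|i IH] iL; [rewrite addn0|have := sa i iL; have := IH (ltnW iL); lia].
  have lo i : (i < L)%N -> (L <= a i + i.+1)%N.
    move=> iL; have [d e] : exists d, (i + d)%N = L.-1 by exists (L.-1 - i)%N; lia.
    elim: d i iL e => [|d IH] i iL e; first by lia.
    have := sa i ltac:(lia); have := IH i.+1 ltac:(lia) ltac:(lia); lia.
  suff -> : flag_det x L a f = 1 by [].
  rewrite /flag_det (_ : flag_mx x L a f = 1%:M) ?det1 //; apply/matrixP => i j.
  rewrite !mxE f0 // /csym_shift /= -val_eqE /=.
  have := up i (ltn_ord i); have := lo i (ltn_ord i); have := ltn_ord j.
  move=> jL lo_i up_i; case: ifP => le.
    by congr ((nat_of_bool _)%:R); lia.
  by case: eqP => // e; lia.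
suff -> : flag_det x L a f = 0 by [].
rewrite /flag_det (expand_det_row _ (Ordinal L0)) big1 // => j _.
rewrite !mxE f0 // /csym_shift /=; have := ltn_ord j.
by case: ifP => _ jL; [case: eqP; [lia|rewrite mul0r]|rewrite mul0r].
Qed.

(* Shapes correspond to strictly decreasing a. Allowing equalities keeps the  *)
(* class closed under flag_det_split at the first row of the last block of    *)
(* equal flags; equal a and equal flags in adjacent rows kill the determinant. *)
Lemma flag_det_pos L a f :
  (forall i, (i.+1 < L)%N -> (a i.+1 <= a i)%N) ->
  (forall i, (i.+1 < L)%N -> (f i <= f i.+1)%N) -> P (flag_det x L a f).
Proof.
have [N] := ubnP (\sum_(i < L) a i + \sum_(i < L) f i)%N.
elim: N a f => // N IH a f sN da inf.
have [/existsP[t /andP[tL /andP[/eqP ea /eqP ef]]]|nodup] :=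
  boolP [exists t : 'I_L, [&& (t.+1 < L)%N, a t == a t.+1 & f t == f t.+1]].
  by rewrite (flag_det_dup x tL).
have sa t : (t.+1 < L)%N -> f t = f t.+1 -> (a t.+1 < a t)%N.
  move=> tL ef; rewrite ltn_neqAle da // andbT; apply: contra nodup => /eqP ea.
  by apply/existsP; exists (Ordinal (ltnW tL)); rewrite /= tL ea ef !eqxx.
have fm i j : (i <= j < L)%N -> (f i <= f j)%N.
  case/andP; elim: j => [|j IHj]; first by rewrite leqn0 => /eqP->.
  rewrite leq_eqVlt => /orP[/eqP-> //|ij jL].
  by apply: leq_trans (inf _ jL); apply: IHj => //; apply: ltnW.
case E: (f L.-1) => [|v].
  have f0 i : (i < L)%N -> f i = 0%N by move=> iL; have := fm i L.-1; lia.
  apply: flag_det_empty_flag_pos => // i iL; apply: sa => //.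
  by rewrite !f0 //; lia.
case: (posnP L) => [L0|L0].
  by rewrite /flag_det; move: (flag_mx _ _ _ _); rewrite L0 => M; rewrite det_mx00.
(* The first row attaining the largest flag is chosen: lowering its flag keeps the flags increasing,
   and the next row, if any, has the same flag, so [sa] leaves room to lower [a t]. *)
have ex : exists t, (t < L)%N && (f t == v.+1) by exists L.-1; rewrite E eqxx andbT; lia.
case: (ex_minnP ex) => t /andP[tL /eqP ft] tmin.
have inf' i : (i.+1 < L)%N -> (upd f t v i <= upd f t v i.+1)%N.
  move=> iL; have infi := inf i iL; rewrite /upd.
  case: (i =P t) => [e|it]; case: (i.+1 =P t) => [e'|it'] //.
    by rewrite e in infi; rewrite e; lia.
  have := tmin i; rewrite (ltnW iL) e' ft in infi *; case: eqP => [_|]; last by lia.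
  by move=> /(_ isT); lia.
have sf := sum_upd tL ft.
case at_: (a t) => [|u]; first by rewrite (flag_det_split0 x tL at_ ft); apply: IH => //; lia.
have saU := sum_upd tL at_.
rewrite (flag_det_split x tL at_ ft); apply: PD; first by apply: IH => //; lia.
apply/PX/IH => //; first by lia.
move=> i iL; have dai := da i iL; rewrite /upd.
case: (i.+1 =P t) => [e'|it']; case: (i =P t) => [e|it] //; try lia.
  by rewrite e' at_ in dai; lia.
have f1 := inf i iL; have f2 := fm i.+1 L.-1; have := sa i iL.
by rewrite e at_ ft E in f1 f2 *; lia.
Qed.

(** The flag descends from [f] to [f'] one unit at a time. Each unit accounts for a variable times a
    determinant with one entry of [a] lowered, whose [a] may only decrease weakly; this is the case
    that [flag_det_pos] covers. *)
Lemma flag_det_sub_pos L a f f' :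
  (forall i, (i.+1 < L)%N -> (a i.+1 < a i)%N) ->
  (forall i, (i.+1 < L)%N -> (f i <= f i.+1)%N) ->
  (forall i, (i.+1 < L)%N -> (f' i <= f' i.+1)%N) ->
  (forall i, (i < L)%N -> (f' i <= f i)%N) ->
  P (flag_det x L a f - flag_det x L a f').
Proof.
have [N] := ubnP (\sum_(i < L) f i)%N.
elim: N f => // N IH f sN sa inf inf' le.
have [/existsP ex|no] := boolP [exists t : 'I_L, (f' t < f t)%N]; last first.
  rewrite (@eq_flag_det x L a a f f') ?subrr // => i iL.
  apply/eqP; rewrite eqn_leq le // andbT leqNgt; apply: contra no => lt.
  by apply/existsP; exists (Ordinal iL).
have ex' : exists t, (t < L)%N && (f' t < f t)%N.
  by case: ex => t ft; exists t; rewrite ltn_ord.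
(* Before the first row [t] where they differ, [f] equals [f'], which is at most [f' t < f t]; hence
   lowering [f t] keeps the flag increasing. *)
case: (ex_minnP ex') => t /andP[tL ft'] tmin.
case ft: (f t) => [|v]; first by rewrite ft in ft'.
have IHt : P (flag_det x L a (upd f t v) - flag_det x L a f').
  apply: IH => //; first by have := sum_upd tL ft; lia.
    move=> i iL; have infi := inf i iL; rewrite /upd.
    case: (i =P t) => [e|it]; case: (i.+1 =P t) => [e'|it'] //.
      by rewrite e in infi; rewrite e; lia.
    have := tmin i; have := inf' i iL; have := le i (ltnW iL).
    rewrite (ltnW iL) e' ft in infi ft' *.
    by case: ltngtP => //; lia.
  move=> i iL; rewrite /upd; case: eqP => [->|_]; last exact: le.
  by rewrite -ltnS -ft.
case at_: (a t) => [|u]; first by rewrite (flag_det_split0 x tL at_ ft).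
rewrite (flag_det_split x tL at_ ft) addrAC; apply: PD => //; apply: PX.
apply: flag_det_pos => // i iL; have sai := sa i iL; rewrite /upd.
case: (i.+1 =P t) => [e'|it']; case: (i =P t) => [e|it] //; try lia.
- by rewrite e' at_ in sai; lia.
- by rewrite e at_ in sai; rewrite e; lia.
Qed.

End Positivity.

Lemma flag_det_dominant L x (nu : nat -> nat) :
  flag_det x L (fun i => nu i + (L - i.+1))%N succn = \prod_(i < L) x i ^+ nu i.
Proof.
elim: L x nu => [|L IH] x nu.
  by rewrite big_ord0 /flag_det det_mx00.
(* Unitriangular column operations that remove the variable [x 0] from all columns but the first
   ([csym_shift_drop_first]). The top row keeps only its first entry [x 0 ^+ nu 0], and the
   remaining minor is the same determinant in the shifted variables. *)
pose V : 'M[R]_L.+1 := \matrix_(j, k) ((j == k)%:R - x 0%N * (j.+1 == k :> nat)%:R).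
have detV : \det V = 1.
  rewrite -det_tr det_trig; last first.
    apply/is_trig_mxP => i j ij; rewrite !mxE.
    by rewrite -val_eqE /= !(gtn_eqF) ?mulr0 ?subr0 //; lia.
  by rewrite big1 // => i _; rewrite !mxE eqxx gtn_eqF // mulr0 subr0.
pose M := flag_mx x L.+1 (fun i => nu i + (L.+1 - i.+1))%N succn.
rewrite /flag_det -/M -[\det M]mulr1 -[X in \det M * X]detV -det_mulmx.
have MV0 i : (M *m V) i ord0 = M i ord0.
  rewrite mxE (bigD1 ord0) //= big1 => [|j j0]; first by rewrite !mxE /= mulr0 subr0 mulr1 addr0.
  by rewrite !mxE (negbTE j0) /= mulr0 subr0 mulr0.
have MVS i (k : 'I_L) : (M *m V) i (lift ord0 k) =
    csym_shift (x \o succn) i (nu i + (L - i))%N (L - k.+1).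
  have k0 : (k < L.+1)%N by apply: ltnW; rewrite ltnS.
  rewrite mxE (bigD1 (lift ord0 k)) //= (bigD1 (Ordinal k0)) /=; last first.
    by rewrite -val_eqE /= /bump /=; lia.
  rewrite big1 => [|j /andP[/negbTE j1 /negbTE j2]]; last first.
    rewrite !mxE j1 sub0r.
    rewrite -val_eqE /= in j2.
    by rewrite [(_.+1 == _)%N](_ : _ = false) ?mulr0 ?oppr0 ?mulr0 // -lift0 eqSS.
  rewrite !mxE eqxx /= -!val_eqE /= /bump /= !add1n !subSS eqxx.
  rewrite [(k.+2 == _)%N](_ : _ = false); last by apply/eqP; lia.
  rewrite [(_ == k.+1 :> nat)%N](_ : _ = false); last by apply/eqP; lia.
  rewrite (csym_shift_drop_first x i _ (L - k.+1)).
  rewrite (_ : (L - k.+1).+1 = (L - k)%N); last by have := ltn_ord k; lia.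
  by rewrite /=; ring.
rewrite (expand_det_row _ ord0) [LHS]big_ord_recl [X in _ + X]big1 => [|k _]; last first.
  rewrite MVS /csym_shift /= subn0 (_ : (_ <= _)%N); last by lia.
  by rewrite (_ : (_ == _) = false) ?mul0r //; apply/eqP; have := ltn_ord k; lia.
rewrite addr0 MV0 mxE /= /csym_shift subSS !subn0 leq_addl addnK.
have csym1 m : csym x 1 m = x 0%N ^+ m.
  by elim: m => // m IHm; rewrite csymS IHm add0r exprS.
rewrite csym1 big_ord_recl; congr (_ * _).
rewrite /cofactor /= expr0 mul1r.
have := IH (x \o succn) (nu \o succn); rewrite /flag_det => <-.
congr (\det _); apply/matrixP => i j.
rewrite [LHS]mxE [LHS]mxE MVS mxE /= /bump /= add1n.
by congr (csym_shift _ _ _ _).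
Qed.

End FlagDeterminant.

(** * Sums over reduced words and divided differences *)

Lemma big_fpowersetU1 (R : nmodType) (K : choiceType) (b : K) (X : {fset K})
    (G : {fset K} -> R) : b \notin X ->
  (\sum_(D <- fpowerset (b |` X)) G D =
   \sum_(D <- fpowerset X) (G D + G (b |` D)))%R.
Proof.
move=> bX; rewrite big_split /= (big_fsetID _ (fun D : {fset K} => b \notin D)).
congr (_ + _)%R.
  apply: congr_big => //; congr enum_fset; apply/fsetP => D.
  rewrite !inE /= !fpowersetE; apply/andP/idP => [[/fsubsetP sD bD]|/fsubsetP sD].
    by apply/fsubsetP => y yD; move: (sD y yD); rewrite !inE; case: eqP yD bD => [->->|].
  split; first by apply/fsubsetP => y /sD; rewrite !inE orbC => ->.
  by apply: contra bX => /sD.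
transitivity (\sum_(D <- [fset b |` D | D in fpowerset X]) G D)%R; last first.
  rewrite big_imfset //=.
  move=> D1 D2; rewrite !fpowersetE => /fsubsetP s1 /fsubsetP s2 e.
  apply/fsetP => y; move/fsetP/(_ y): e; rewrite !inE.
  by case: eqP => //= -> _; apply/idP/idP => [/s1|/s2]; rewrite (negbTE bX).
apply: congr_big => //; congr enum_fset; apply/fsetP => D.
rewrite !inE /= negbK; apply/andP/imfsetP => /= [[]|[D' + ->]]; rewrite !fpowersetE.
  move=> /fsubsetP sD bD; exists (D `\ b); last by rewrite fsetD1K.
  rewrite fpowersetE; apply/fsubsetP => y; rewrite !inE => /andP[/negbTE yb /sD].
  by rewrite !inE yb.
by move=> s; rewrite fsetUS // fset1U1.
Qed.

(** The order matters: it is the reading order of words, in which a crossing at [(r, c)] contributes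
    the generator [r + c]. *)
Definition boxes (n : nat) : seq box :=
  [seq (r, c) | r <- iota 0 n, c <- rev (iota 0 (n.-1 - r))].

Lemma mem_boxes n (b : box) : (b \in boxes n) = (b.1 + b.2.+1 < n).
Proof.
case: b => r c; apply/allpairsPdep/idP => /= [[r' [c' [+ + [-> ->]]]]|rc].
  by rewrite mem_rev !mem_iota; lia.
by exists r, c; rewrite mem_rev !mem_iota; split=> //; lia.
Qed.

Lemma boxes_uniq n : uniq (boxes n).
Proof.
rewrite allpairs_uniq_dep ?iota_uniq // => [r _|[r c] [r' c'] _ _ /= [-> ->] //].
by rewrite rev_uniq iota_uniq.
Qed.

Lemma staircaseE n : staircase n = [fset b in boxes n].
Proof.
apply/fsetP => -[r c]; rewrite inE /= mem_boxes /=.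
apply/imfset2P/idP => /= [[r' + [c' + [-> ->]]]|rc].
  by rewrite ?inE /= ?mem_iota; lia.
by exists r; [|exists c]; rewrite ?inE /= ?mem_iota //; lia.
Qed.

(** [None] stands for a vanishing nilCoxeter product, that is, for a word that is not reduced. *)
Fixpoint run n (D : {fset box}) (w : 'S_n) (bs : seq box) : option 'S_n :=
  if bs is b :: bs' then
    if b \in D then
      if asc w (b.1 + b.2) then run D (adj_swap n (b.1 + b.2) * w)%g bs' else None
    else run D w bs'
  else Some w.

Lemma eq_run n (D D' : {fset box}) (w : 'S_n) bs :
  {in bs, D =i D'} -> run D w bs = run D' w bs.
Proof.
elim: bs w => //= b bs IH w e; have e' : {in bs, D =i D'}.
  by move=> y ybs; apply: e; rewrite inE ybs orbT.
by rewrite (e b) ?inE ?eqxx // !IH.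
Qed.

Section Transfer.

Variables (R : comNzRingType) (n : nat) (x : nat -> R).
Local Open Scope ring_scope.

(** Expanding the product means choosing at each box the term 1 or the crossing term, so the
    summands are indexed by sets of boxes. *)
Lemma perm_row_word (bs : seq box) (w0 : 'S_n) : uniq bs ->
  perm_row R w0 *m
    \prod_(b <- bs) hterm (nil_gen R n) (x b.1)%:M (b.1 + b.2) =
  \sum_(D <- fpowerset [fset b in bs])
    (\prod_(b <- D) x b.1) *:
    (if run D w0 bs is Some w then perm_row R w else 0).
Proof.
elim: bs w0 => [|b bs IH] w0 /=.
  move=> _; rewrite big_nil mulmx1.
  have -> : [fset b in [::]] = fset0 :> {fset box} by apply/fsetP=> y; rewrite !inE.
  by rewrite fpowerset0 big_seq_fset1 big_seq_fset0 scale1r.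
move=> /andP[bbs ubs]; rewrite big_cons.
have -> : [fset y in b :: bs] = b |` [fset y in bs].
  by apply/fsetP=> y; rewrite !inE.
have bX : b \notin [fset y in bs] by rewrite inE.
rewrite big_fpowersetU1 // big_split /= {1}/hterm mulmxA mulmxDr mulmx1 mulmxDl.
congr (_ + _).
  rewrite IH //; apply: eq_big_seq => D; rewrite fpowersetE => /fsubsetP sD.
  by rewrite ifN //; apply: contra bX => /sD.
have -> : (x b.1)%:M * nil_gen R n (b.1 + b.2) = x b.1 *: nil_gen R n (b.1 + b.2).
  exact: mul_scalar_mx.
rewrite -scalemxAr perm_row_gen -scalemxAl.
rewrite [RHS](_ : _ = \sum_(D <- fpowerset [fset y in bs]) x b.1 *:
   ((\prod_(b <- D) x b.1) *: if asc w0 (b.1 + b.2) then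
   (if run D (adj_swap n (b.1 + b.2) * w0)%g bs is Some w then perm_row R w else 0) else 0)).
  rewrite -scaler_sumr; congr (_ *: _).
  case: ifP => _; first by rewrite IH.
  by rewrite mul0mx big1 // => D _; rewrite scaler0.
apply: eq_big_seq => D; rewrite fpowersetE => /fsubsetP sD.
rewrite fset1U1 big_fsetU1 /=; last by apply: contra bX => /sD.
rewrite scalerA; congr (_ *: _); case: ifP => // _.
rewrite (@eq_run _ (b |` D) D) // => y ybs; rewrite !inE.
by case: eqP ybs bbs => // -> ->.
Qed.

Definition word_sum (w : 'S_n) : R :=
  \sum_(D <- fpowerset (staircase n) | run D 1%g (boxes n) == Some w)
    \prod_(b <- D) x b.1.

Definition transfer : 'M[R]_#|{: 'S_n}| :=
  \prod_(r <- iota 0 n) hrow (nil_gen R n) (x r)%:M r (n.-1 - r).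

Lemma word_sumE (w : 'S_n) :
  word_sum w = (perm_row R 1%g *m transfer) 0 (enum_rank w).
Proof.
have -> : transfer = \prod_(b <- boxes n)
    hterm (nil_gen R n) (x b.1)%:M (b.1 + b.2).
  rewrite /transfer /boxes big_allpairs_dep; apply: eq_big_seq => r _.
  rewrite /hrow (_ : iota r _ = map (addn r) (iota 0 (n.-1 - r))).
    by rewrite -map_rev big_map.
  by rewrite -iotaDl addn0.
rewrite perm_row_word ?boxes_uniq // -staircaseE summxE /word_sum big_mkcond /=.
apply: eq_bigr => D _; rewrite mxE; case: run => [w'|]; last by rewrite mxE mulr0.
rewrite mxE eqxx /= (inj_eq enum_rank_inj) (inj_eq Some_inj) eq_sym.
by case: eqP; rewrite ?mulr1 ?mulr0.
Qed.

End Transfer.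

(** * Divided differences of the generating function *)

Section DividedDifference.

Variables (R : comNzRingType) (n : nat).
Local Open Scope ring_scope.

Lemma central_scalar (a : R) : central (a%:M : 'M[R]_#|{: 'S_n}|).
Proof. by move=> B; apply/esym/scalar_mxC. Qed.

Lemma transfer_divdiff (x : nat -> R) f : (f.+1 < n)%N ->
  transfer n x - transfer n (swap_vars f x) =
  (x f - x f.+1)%:M * (transfer n x * nil_gen R n f).
Proof.
move=> fn.
pose pre (y : nat -> R) : 'M[R]_#|{: 'S_n}| :=
  \prod_(r <- iota 0 f) hrow (nil_gen R n) (y r)%:M r (n.-1 - r).
pose post (y : nat -> R) : 'M[R]_#|{: 'S_n}| :=
  \prod_(r <- iota f.+2 (n - f.+2)) hrow (nil_gen R n) (y r)%:M r (n.-1 - r).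
have E y : transfer n y = pre y * (hrow (nil_gen R n) (y f)%:M f (n - f.+2).+1
    * hrow (nil_gen R n) (y f.+1)%:M f.+1 (n - f.+2)) * post y.
  rewrite /transfer (_ : iota 0 n = iota 0 f ++ f :: f.+1 :: iota f.+2 (n - f.+2)).
    rewrite big_cat !big_cons /= -!mulrA.
    by congr (_ * (hrow _ _ _ _ * (hrow _ _ _ _ * _))); lia.
  by rewrite {1}(_ : n = f + (n - f.+2).+2)%N ?iotaD //; lia.
have Epre : pre (swap_vars f x) = pre x.
  apply: eq_big_seq => r; rewrite mem_iota => rf.
  by rewrite /swap_vars /swap_nat; do !case: eqP => //; lia.
have Epost : post (swap_vars f x) = post x.
  apply: eq_big_seq => r; rewrite mem_iota => rf.
  by rewrite /swap_vars /swap_nat; do !case: eqP => //; lia.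
rewrite !E Epre Epost !swap_vars_at -mulrBl -mulrBr.
rewrite hrow_divdiff; [|exact: nil_gen_sq|exact: nil_gen_braid|exact: nil_gen_comm|exact: central_scalar..].
rewrite raddfB /=.
have cxy : central ((x f)%:M - (x f.+1)%:M : 'M[R]_#|{: 'S_n}|).
  by move=> B; rewrite mulrBl mulrBr !(central_scalar _ B).
(* Rows from [f.+2] on only involve generators of index at least [f.+2], which commute with the
   generator [f]. *)
have cpost : post x * nil_gen R n f = nil_gen R n f * post x.
  rewrite /post big_seq; apply: (big_ind (fun B => B * _ = _ * B)).
  - by rewrite mul1r mulr1.
  - by move=> B C eB eC; rewrite -mulrA eC mulrA eB mulrA.
  move=> r; rewrite mem_iota => /andP[fr _].
  by apply: hrow_gen_comm => //; [exact: nil_gen_comm|exact: central_scalar].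
rewrite (mulrA (pre x)) -(cxy (pre x)) -!mulrA.
by rewrite cpost.
Qed.

Lemma mul_nil_gen (V : 'rV[R]_#|{: 'S_n}|) f (w : 'S_n) :
  asc w f -> (V *m nil_gen R n f) 0 (enum_rank (adj_swap n f * w)%g) =
             V 0 (enum_rank w).
Proof.
move=> a; rewrite mxE (bigD1 (enum_rank w)) //= mxE !enum_rankK a eqxx mulr1.
rewrite big1 ?addr0 // => p pw; rewrite mxE enum_rankK.
case: eqP => [e|]; last by rewrite andbF mulr0.
case/eqP: pw; rewrite -[p]enum_valK; congr enum_rank.
by rewrite -(adj_swapK f (enum_val p)) -e adj_swapK.
Qed.

(** The coefficient of [adj_swap n f * w] in [transfer_divdiff]; only [w] contributes to it on the
    right. *)
Lemma word_sum_divdiff (x : nat -> R) f (w : 'S_n) : asc w f ->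
  word_sum x (adj_swap n f * w)%g - word_sum (swap_vars f x) (adj_swap n f * w)%g
  = (x f - x f.+1) * word_sum x w.
Proof.
move=> a; have fn : (f.+1 < n)%N by case/andP: a.
rewrite !word_sumE -(mul_nil_gen _ a) -mulmxA.
set q := enum_rank _.
have -> : (x f - x f.+1) * (perm_row R 1%g *m (transfer n x *m nil_gen R n f)) 0 q
    = (perm_row R 1%g *m ((x f - x f.+1)%:M * (transfer n x * nil_gen R n f))) 0 q.
  rewrite (_ : _%:M * (_ * _) = (x f - x f.+1) *: (transfer n x *m nil_gen R n f)).
    by rewrite -scalemxAr [RHS]mxE.
  exact: mul_scalar_mx.
have entryB (B C : 'rV[R]_#|{: 'S_n}|) : (B - C) 0 q = B 0 q - C 0 q.
  by rewrite !mxE.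
by rewrite -transfer_divdiff // mulmxBr entryB.
Qed.

End DividedDifference.

(** * Pipe dreams *)

Section Pipes.

Variables (n : nat) (D : {fset box}).

Definition reach (p : nat) (s : bool * nat * nat) : Prop :=
  exists a, iter a (pipe_step D) (true, 0, p.+1) = s.

Lemma reach_step p s : reach p s -> reach p (pipe_step D s).
Proof. by case=> a <-; exists a.+1. Qed.

(** Every step moves one row down or one column left, so the place of a pipe determines the time. *)
Lemma iter_time a p d r c :
  iter a (pipe_step D) (true, 0, p.+1) = (d, r, c.+1) -> a + c = r + p.
Proof.
elim: a d r c => [|a IH] d r c /=; first by case=> _ <- <-.
case: (iter a _ _) IH => -[d' r'] [|c'] IH //=.
by case: ifP => _ [_ <- e]; have := IH _ _ _ erefl; lia.
Qed.

Lemma pipe_step_inj s t d r c :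
  pipe_step D s = (d, r, c.+1) -> pipe_step D t = (d, r, c.+1) -> s = t.
Proof.
case: s t => [[d1 r1] [|c1]] [[d2 r2] [|c2]] //=.
case: eqP => [<-|/eqP n1] [<- <- e1]; case: eqP => [<-|/eqP n2] [//  e2 e3].
  by move: e1; rewrite -{}e2 -{}e3 => ->.
move: n1 n2; rewrite e2 e3 e1.
by case: (_ \in D); case: d1 => //; case: d2.
Qed.

(** Pipes can be followed backwards by [pipe_step_inj], and no step ends on the top side of the
    first row, where they start. *)
Lemma reach_inj p q d r c : reach p (d, r, c.+1) -> reach q (d, r, c.+1) -> p = q.
Proof.
case=> a; elim: a q d r c => [|a IH] q d r c.
  move=> /= [<- <- <-] [[[//]|b] /=].
  by case: (iter b _ _) => -[d' r'] [|c'] //=; case: ifP.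
move=> /= ea [[|b] eb].
  by move: eb ea => /= [<- <- <-]; case: (iter a _ _) => -[d' r'] [|c'] //=; case: ifP.
have e := pipe_step_inj ea eb.
case E: (iter a _ _) ea => [[d' r'] [|c']] // _.
by apply: (IH q d' r' c' E); exists b; apply: etrans (esym e) E.
Qed.

Lemma mem_pipe p d r c : p < n -> r < n ->
  (d, r, c.+1) \in pipe n D p <-> reach p (d, r, c.+1).
Proof.
move=> pn rn; split=> [/trajectP[a _ ->]|[a ea]]; first by exists a.
by apply/trajectP; exists a => //; have := iter_time ea; lia.
Qed.

Lemma exit_rowE p i : p < n -> i < n -> reach p (false, i, 0) ->
  exit_row n D p = i.
Proof.
have row_mono b s : s.1.2 <= (iter b (pipe_step D) s).1.2.
  elim: b => //= b IH; apply: (leq_trans IH).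
  by case: (iter b _ _) => -[d r] [|c] //=; case: ifP => //=.
have fixed b j : iter b (pipe_step D) (false, j, 0) = (false, j, 0).
  by elim: b => //= b ->.
move=> pn iN [a ea]; rewrite /exit_row.
case: (leqP a (2 * n)) => [le_a|lt_a].
  by rewrite -(subnK le_a) iterD ea fixed.
case E: (iter (2 * n) _ _) => [[d r] [|c]] /=.
  move: ea; rewrite -(subnK (ltnW lt_a)) iterD E.
  have -> : iter (a - 2 * n) (pipe_step D) (d, r, 0) = (d, r, 0).
    by elim: (a - 2 * n) => //= b ->.
  by case.
have t := iter_time E; have := row_mono (a - 2 * n) (d, r, c.+1).
by rewrite -E -iterD subnK ?(ltnW lt_a) // ea E /=; lia.
Qed.

(* Boxes are processed row by row, each row from right to left, and the n     *)
(* pipes cross the boundary of the processed region at positions numbered     *)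
(* from south-west to north-east. This is the state of the pipe at position i *)
(* when the columns >= c of row r have been processed.                        *)
Definition front (r c i : nat) : bool * nat * nat :=
  if i < r then (false, i, 0) else if i < r + c then (true, r, (i - r).+1)
  else if i == r + c then (false, r, c) else (true, r.+1, i - r).

Definition on_front (w : 'S_n) (r c : nat) : Prop :=
  forall i, i < n -> reach (val_at w i) (front r c i).

Definition step_perm (w : 'S_n) (b : box) : 'S_n :=
  if b \in D then (adj_swap n (b.1 + b.2) * w)%g else w.

(** Position [r + c] enters box [(r, c)] from the top and [(r + c).+1] from the right. Turning pipes
    leave through the left and bottom sides at the same positions; crossing pipes exchange them. *)
Lemma on_front_step w r c : r + c.+1 < n -> on_front w r c.+1 ->
  on_front (step_perm w (r, c)) r c.
Proof.
move=> rc Iw i iN; rewrite /step_perm /=.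
case: (ltngtP i (r + c)) => irc.
- have -> : front r c i = front r c.+1 i by rewrite /front; do !case: ifP => //; lia.
  case: ifP => _; last exact: Iw.
  rewrite val_at_swap; last by lia.
  rewrite (_ : swap_nat _ _ = i); first exact: Iw.
  by rewrite /swap_nat; do !case: eqP => //; lia.
- case: (ltngtP i (r + c).+1) => irc'; first by lia.
    have -> : front r c i = front r c.+1 i.
      by rewrite /front; do !case: ifP => //; lia.
    case: ifP => _; last exact: Iw.
    rewrite val_at_swap; last by lia.
    rewrite (_ : swap_nat _ _ = i); first exact: Iw.
    by rewrite /swap_nat; do !case: eqP => //; lia.
  have -> : front r c i = (true, r.+1, c.+1).
    rewrite /front; do !case: ifP => //; try lia.
    by move=> _ _ _; congr (_, _, _); lia.
  case: ifP => bD.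
    rewrite val_at_swap; last by lia.
    rewrite (_ : swap_nat _ _ = r + c); last by rewrite /swap_nat; do !case: eqP => //; lia.
    have := reach_step (Iw (r + c) ltac:(lia)).
    rewrite (_ : front _ _ _ = (true, r, c.+1)) /= ?bD //.
    by rewrite /front; do !case: ifP => //; try lia; move=> *; congr (_, _, _); lia.
  have := reach_step (Iw i iN).
  rewrite (_ : front _ _ _ = (false, r, c.+1)) /= ?bD //.
  by rewrite /front; do !case: ifP => //; lia.
- have -> : front r c i = (false, r, c).
    by rewrite /front; do !case: ifP => //; lia.
  case: ifP => bD.
    rewrite val_at_swap; last by lia.
    rewrite (_ : swap_nat _ _ = (r + c).+1); last by rewrite /swap_nat; do !case: eqP => //; lia.
    have := reach_step (Iw (r + c).+1 ltac:(lia)).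
    rewrite (_ : front _ _ _ = (false, r, c.+1)) /= ?bD //.
    by rewrite /front; do !case: ifP => //; lia.
  have := reach_step (Iw i iN).
  rewrite (_ : front _ _ _ = (true, r, c.+1)) /= ?bD //.
  by rewrite /front; do !case: ifP => //; try lia; move=> *; congr (_, _, _); lia.
Qed.

(** Only the last pipe moves: it turns to the left in the box of row [r.+1] just outside the
    staircase. *)
Lemma on_front_next_row w r : r.+1 < n -> (r.+1, n - r.+2) \notin D ->
  on_front w r 0 -> on_front w r.+1 (n - r.+2).
Proof.
move=> rn bD Iw i iN; case: (ltnP i n.-1) => iN1.
  have -> : front r.+1 (n - r.+2) i = front r 0 i; last exact: Iw.
  by rewrite /front; do !case: ifP => //; try lia; move=> *; congr (_, _, _); lia.
have := reach_step (Iw i iN).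
rewrite (_ : front r 0 i = (true, r.+1, (n - r.+2).+1)) /= ?(negbTE bD) /=.
  rewrite (_ : front _ _ _ = (false, r.+1, n - r.+2)) //.
  by rewrite /front; do !case: ifP => //; lia.
by rewrite /front; do !case: ifP => //; try lia; move=> *; congr (_, _, _); lia.
Qed.

Lemma on_front_start : (0, n.-1) \notin D -> on_front 1%g 0 n.-1.
Proof.
move=> bD i iN; rewrite (val_at_ord _ (Ordinal iN)) perm1 /=.
case: (ltnP i n.-1) => iN1.
  exists 0; rewrite /front /=; do !case: ifP => //; try lia.
  by move=> *; congr (_, _, _); lia.
exists 1; rewrite /= (_ : i = n.-1); last by lia.
rewrite (negbTE bD) /= /front; do !case: ifP => //; try lia.
Qed.

Definition same_pair (p q a b : nat) : bool :=
  (p == a) && (q == b) || (p == b) && (q == a).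

Lemma cross_on_front w r c p q : r + c.+1 < n -> on_front w r c.+1 ->
  p < n -> q < n ->
  cross_at n D p q (r, c) =
  same_pair p q (val_at w (r + c)) (val_at w (r + c).+1).
Proof.
move=> rc Iw pn qn; have rn : r < n by lia.
have top : reach (val_at w (r + c)) (true, r, c.+1).
  have := Iw (r + c) ltac:(lia); rewrite (_ : front _ _ _ = (true, r, c.+1)) //.
  by rewrite /front; do !case: ifP => //; try lia; move=> *; congr (_, _, _); lia.
have right : reach (val_at w (r + c).+1) (false, r, c.+1).
  have := Iw (r + c).+1 ltac:(lia); rewrite (_ : front _ _ _ = (false, r, c.+1)) //.
  by rewrite /front; do !case: ifP => //; lia.
have E d p' a : p' < n -> reach a (d, r, c.+1) ->
    ((d, r, c.+1) \in pipe n D p') = (p' == a).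
  move=> p'n ra; apply/idP/eqP => [/mem_pipe rp|e].
    by apply: (reach_inj _ ra); apply: rp.
  by apply/mem_pipe; rewrite ?e // -e.
rewrite /cross_at /= !(E true _ _ _ top) // !(E false _ _ _ right) //.
by rewrite /same_pair; congr (_ || _); rewrite andbC.
Qed.

Definition arrange (w : 'S_n) (bs : seq box) : 'S_n := foldl step_perm w bs.

Lemma run_arrange w bs w' : run D w bs = Some w' -> w' = arrange w bs.
Proof.
elim: bs w => [|b bs IH] w /=; first by case.
by rewrite /step_perm; case: ifP => _; [case: ifP => // _|]; apply: IH.
Qed.

Fixpoint tracked (w : 'S_n) (bs : seq box) : Prop :=
  if bs is b :: bs' then
    (b \in D -> (b.1 + b.2).+1 < n /\ forall p q, p < n -> q < n ->
       cross_at n D p q b =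
       same_pair p q (val_at w (b.1 + b.2)) (val_at w (b.1 + b.2).+1))
    /\ tracked (step_perm w b) bs'
  else True.

Lemma tracked_cat w bs1 bs2 :
  tracked w bs1 -> tracked (arrange w bs1) bs2 -> tracked w (bs1 ++ bs2).
Proof. by elim: bs1 w => //= b bs IH w [? ?] ?; split=> //; apply: IH. Qed.

Lemma on_front_row c w r : r + c < n -> on_front w r c ->
  tracked w [seq (r, c') | c' <- rev (iota 0 c)] /\
  on_front (arrange w [seq (r, c') | c' <- rev (iota 0 c)]) r 0.
Proof.
elim: c w => [//|c IH] w rc Iw.
have Iw' := on_front_step rc Iw.
have [|t1 t2] := IH _ _ Iw'; first by lia.
rewrite -addn1 iotaD rev_cat /=; split=> //; split=> // _; split; first lia.
by move=> p q pn qn; apply: cross_on_front.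
Qed.

Lemma on_front_boxes : D `<=` staircase n -> 
  tracked 1%g (boxes n) /\
  forall i, i < n -> reach (val_at (arrange 1%g (boxes n)) i) (false, i, 0).
Proof.
move=> /fsubsetP sD; have out r c : n <= r + c.+1 -> (r, c) \notin D.
  by move=> rc; apply/negP => /sD; rewrite staircaseE inE /= mem_boxes /=; lia.
case: (posnP n) => n0.
  have -> : boxes n = [::] by rewrite /boxes n0.
  by split=> // i; rewrite {1}n0.
have rows m r w : r + m = n -> 0 < m -> on_front w r (n.-1 - r) ->
  let bs := [seq (r', c) | r' <- iota r m, c <- rev (iota 0 (n.-1 - r'))] in
  tracked w bs /\ on_front (arrange w bs) n.-1 0.
  elim: m r w => [//|m IH] r w rm _ Iw.
  have [|t1 t2] := on_front_row _ Iw; first by lia.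
  case: m => [|m] in IH rm *.
    by rewrite /= cats0; split=> //; rewrite [X in on_front _ X](_ : n.-1 = r); [exact: t2 | lia].
  have [|||t3 t4] := IH r.+1 (arrange w [seq (r, c') | c' <- rev (iota 0 (n.-1 - r))]).
  - by lia.
  - by [].
  - rewrite (_ : n.-1 - r.+1 = n - r.+2); last by lia.
    by apply: on_front_next_row => //; [lia | apply: out; lia].
  split; first by apply: tracked_cat.
  by rewrite [arrange _ _]foldl_cat.
have [|||t1 t2] := rows n 0 1%g => //.
  by rewrite subn0; apply: on_front_start; apply: out; lia.
split=> // i iN; have := t2 i iN; rewrite /front; case: ltngtP => //; try lia.
by move=> ->; rewrite addn0 ltnn eqxx.
Qed.

(** [N p q] counts the crossings of [p] and [q] met so far. Two pipes are inverted in [w] exactly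
    when this number is odd, so while it is at most 1, a crossing at a descent is a second crossing
    of the same pair. *)
Lemma run_reduced bs w (N : nat -> nat -> nat) : tracked w bs ->
  (forall i j, i < j -> j < n ->
     (val_at w j < val_at w i) = odd (N (val_at w i) (val_at w j))) ->
  (forall p q, N p q = N q p) ->
  (forall p q, p < n -> q < n -> p != q -> N p q <= 1) ->
  isSome (run D w bs) = [forall p : 'I_n, forall q : 'I_n, (p != q) ==>
    (N p q + count (fun b => (b \in D) && cross_at n D p q b) bs <= 1)].
Proof.
elim: bs w N => [|b bs IH] w N /=.
  move=> _ _ _ N1; apply/esym/forallP => p; apply/forallP => q; apply/implyP.
  by move=> pq; rewrite addn0; apply: N1.
case=> tb tbs invN symN N1; case: ifP => bD; last first.
  rewrite (IH w N) //; last by move: tbs; rewrite /step_perm bD.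
have [bn cb] := tb bD; set i := (b.1 + b.2)%N in tb tbs bn cb *.
case: ifP => a; last first.
  have i_n : i < n by lia.
  apply/esym/negbTE/forallPn; exists (w (Ordinal i_n)).
  apply/forallPn; exists (w (Ordinal bn)).
  rewrite negb_imply (inj_eq perm_inj) -val_eqE /= neq_ltn ltnSn /=.
  have := invN i i.+1 (ltnSn i) bn.
  have -> : (val_at w i.+1 < val_at w i) = true.
    move: a; rewrite /asc bn /= => /negbT; rewrite -leqNgt leq_eqVlt.
    by case/orP => // /eqP /val_at_inj; lia.
  rewrite cb ?ltn_ord // (val_at_ord w (Ordinal i_n)) (val_at_ord w (Ordinal bn)).
  rewrite /same_pair !eqxx /=; case: (N _ _) => //; lia.
rewrite (IH _ (fun p q => N p q + same_pair p q (val_at w i) (val_at w i.+1))).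
- apply: eq_forallb => p; apply: eq_forallb => q; rewrite cb ?ltn_ord //.
  by rewrite addnA.
- by move: tbs; rewrite /step_perm bD.
- move=> j k jk kn; rewrite !val_at_swap //.
  have vE (c d : nat) : (val_at w c == val_at w d) = (c == d).
    by apply/eqP/eqP => [/val_at_inj|->].
  rewrite /same_pair !vE /swap_nat.
  case: (boolP ((j == i) && (k == i.+1))) => [/andP[/eqP-> /eqP->]|jki].
    rewrite (_ : (if i == i then _ else _) = i.+1) ?eqxx //.
    rewrite (_ : (if i.+1 == i then _ else _) = i); last by case: eqP => //; lia.
    rewrite !eqxx orbT addn1 /= symN -(invN i i.+1) //.
    case/andP: a => _ a; rewrite a.
    by case: ltngtP a.
  set j' := (if j == i then _ else _); set k' := (if k == i then _ else _).
  have jk' : j' < k'.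
    by rewrite /j' /k'; move: jki; do !case: eqP => //=; lia.
  rewrite (_ : _ || _ = false); last first.
    by rewrite /j' /k'; move: jki; do !case: eqP => //=; lia.
  rewrite addn0; apply: invN => //; rewrite /k'; do !case: eqP => //; lia.
- by move=> p q; rewrite symN /same_pair orbC [X in X || _]andbC [X in _ || X]andbC.
- move=> p q pn qn pq.
  have e0 : N (val_at w i) (val_at w i.+1) = 0.
    have := invN i i.+1 (ltnSn i) bn; have := N1 (val_at w i) (val_at w i.+1).
    rewrite !val_at_lt (inj_eq (@val_at_inj _ w)).
    case/andP: a => _ a; rewrite (ltnNge (val_at w i.+1)) (ltnW a) /=.
    have -> : i < n by lia.
    rewrite bn => /(_ isT isT); case: (N _ _) => // -[|m]; lia.
  have := N1 p q pn qn pq; rewrite /same_pair.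
  case: (boolP ((p == _) && (q == _))) => [/andP[/eqP-> /eqP->]|_] /=.
    by rewrite e0.
  case: (boolP ((p == _) && (q == _))) => [/andP[/eqP-> /eqP->]|_] /=; last by rewrite addn0.
  by rewrite symN e0.
Qed.

End Pipes.

Lemma card_crossings n (D : {fset box}) (P : pred box) : D `<=` staircase n ->
  #|` [fset b in D | P b] | = count (fun b => (b \in D) && P b) (boxes n).
Proof.
move=> /fsubsetP sD; rewrite -size_filter cardfE cardE.
rewrite -[LHS](size_map val) -enum_fsetE.
apply: perm_size; apply: uniq_perm; rewrite ?fset_uniq ?filter_uniq ?boxes_uniq //.
move=> b; rewrite mem_filter !inE /=.
case bD: (b \in D) => //=; case: (P b) => //=.
by have := sD b bD; rewrite staircaseE inE.
Qed.

Lemma reduced_run n (D : {fset box}) : D `<=` staircase n ->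
  reduced n D = isSome (run D (1%g : 'S_n) (boxes n)).
Proof.
move=> sD; have [t _] := on_front_boxes sD.
rewrite (run_reduced (N := fun _ _ => 0) t) //.
  apply: eq_forallb => p; apply: eq_forallb => q.
  by rewrite (card_crossings _ sD) add0n.
move=> i j ij jn; have i_n := ltn_trans ij jn.
rewrite (val_at_ord _ (Ordinal i_n)) (val_at_ord _ (Ordinal jn)) !perm1 /=.
by rewrite ltnNge (ltnW ij).
Qed.

Lemma has_perm_arrange n (D : {fset box}) (w : 'S_n) : D `<=` staircase n ->
  has_perm D w = (arrange D 1%g (boxes n) == w).
Proof.
move=> sD; have [_ ex] := on_front_boxes sD.
set v := arrange _ _ _ in ex *.
have exit_v (i : 'I_n) : exit_row n D (v i) = i.
  by apply: exit_rowE; rewrite ?ltn_ord // -val_at_ord; apply: ex.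
apply/forallP/eqP => [ew|<- r]; last by rewrite exit_v.
apply/permP => r; have := eqP (ew r); rewrite -{1}[w r](permKV v) exit_v.
by move/val_inj => e; rewrite -{1}e permKV.
Qed.

Lemma pipe_dream_run n (D : {fset box}) (w : 'S_n) : D `<=` staircase n ->
  reduced n D && has_perm D w = (run D 1%g (boxes n) == Some w).
Proof.
move=> sD; rewrite reduced_run // has_perm_arrange //.
case e: run => [v|] //=; rewrite -(run_arrange e).
by rewrite (inj_eq Some_inj).
Qed.

Lemma schubert_word_sum n (w : 'S_n) : schubert w = word_sum xvar w.
Proof.
rewrite /schubert /word_sum [LHS]big_seq_cond [RHS]big_seq_cond.
apply: eq_bigl => D; case: (boolP (D \in _)) => //=.
by rewrite fpowersetE => /pipe_dream_run ->.
Qed.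

(** * Lehmer codes and the determinantal formula *)

Section LehmerCode.

Variable n : nat.
Implicit Types w : 'S_n.

Definition code w (i : nat) : nat :=
  \sum_(j < n) ((i < j) && (val_at w j < val_at w i)).

Lemma adj_swap_val f (j : 'I_n) : f.+1 < n -> adj_swap n f j = swap_nat f j :> nat.
Proof.
move=> fn; rewrite -val_at_ord -[adj_swap n f]mulg1 val_at_swap //.
have sn : swap_nat f j < n.
  by have := ltn_ord j; rewrite /swap_nat; do !case: eqP => //; lia.
by rewrite (val_at_ord _ (Ordinal sn)) perm1.
Qed.

Lemma code_swapE w f i : f.+1 < n ->
  code (adj_swap n f * w)%g i =
  \sum_(j < n) ((i < swap_nat f j) && (val_at w j < val_at w (swap_nat f i))).
Proof.
move=> fn; rewrite /code (reindex_inj (@perm_inj _ (adj_swap n f))) /=.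
by apply: eq_bigr => j _; rewrite adj_swap_val // !val_at_swap // swap_natK.
Qed.

(** Together with [code_swap_right]: swapping an ascent exchanges the two entries of the code, and
    the new inversion adds one to the entry that arrives on the left. *)
Lemma code_swap_left w f : asc w f -> code (adj_swap n f * w)%g f = (code w f.+1).+1.
Proof.
move=> a; have fn : f.+1 < n by case/andP: a.
have fn' := ltnW fn.
rewrite code_swapE // (bigD1 (Ordinal fn')) //= /code [in RHS](bigD1 (Ordinal fn')) //=.
rewrite (_ : swap_nat f f = f.+1); last by rewrite /swap_nat eqxx.
rewrite ltnSn /= (ltnNge f.+1) leqnSn /= add0n.
case/andP: a => _ ->; rewrite add1n; congr _.+1; apply: eq_bigr => j jf.
congr (nat_of_bool (_ && _)); rewrite -val_eqE /= in jf.
by rewrite /swap_nat (negbTE jf); case: eqP => //; lia.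
Qed.

Lemma code_swap_right w f : asc w f -> code (adj_swap n f * w)%g f.+1 = code w f.
Proof.
move=> a; have fn : f.+1 < n by case/andP: a.
rewrite code_swapE //; apply: eq_bigr => j _.
rewrite (_ : swap_nat f f.+1 = f); last by rewrite /swap_nat; do !case: eqP; lia.
case: (j =P f.+1 :> nat) => [->|jf].
  case/andP: a => _ a; rewrite (ltnNge (val_at w f.+1)) (ltnW a).
  by rewrite !andbF.
by congr (nat_of_bool (_ && _)); rewrite /swap_nat; do !case: eqP => //; lia.
Qed.

Lemma code_swap_other w f i : f.+1 < n -> i != f -> i != f.+1 ->
  code (adj_swap n f * w)%g i = code w i.
Proof.
move=> fn /negbTE i1 /negbTE i2; rewrite code_swapE //; apply: eq_bigr => j _.
rewrite (_ : swap_nat f i = i); last by rewrite /swap_nat i1 i2.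
congr (nat_of_bool (_ && _)).
by rewrite /swap_nat; do !case: eqP => //; lia.
Qed.

Lemma code_asc w f : asc w f -> code w f <= code w f.+1.
Proof.
move=> a; apply: leq_sum => j _; case/andP: a => _ a.
case: (ltngtP f.+1 j) => [fj|fj|<-] /=.
- case: (ltnP (val_at w j) (val_at w f)) => // lt.
  by rewrite (ltn_trans lt a).
- by [].
- by rewrite (ltnNge (val_at w f.+1)) (ltnW a).
Qed.

Lemma code_desc w f : f.+1 < n -> ~~ asc w f -> code w f.+1 < code w f.
Proof.
move=> fn a; rewrite -(adj_swapK f w).
have a' : asc (adj_swap n f * w)%g f by rewrite asc_swap.
by rewrite code_swap_left // code_swap_right // ltnS code_asc.
Qed.

Lemma code_max w i : code w i <= n - i.+1.
Proof.
apply: (@leq_trans (\sum_(j < n) (i < j))).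
  by apply: leq_sum => j _; case: (i < j) => //=; apply: leq_b1.
elim: (n) => [|m IH]; first by rewrite big_ord0.
by rewrite big_ord_recr /=; case: (ltnP i m) IH => im; move: (\sum_(_ < m) _) => s; rewrite subSS; lia.
Qed.

Lemma code1 i : code 1%g i = 0.
Proof.
rewrite /code big1 // => j _; have := ltn_ord j.
case: (ltnP i n) => [i_n|]; last by case: ltnP => //; lia.
rewrite (val_at_ord _ (Ordinal i_n)) (val_at_ord _ j) !perm1 /=.
by case: (ltngtP i j).
Qed.

Definition len w : nat := \sum_(i < n) code w i.

Lemma len_swap w f : asc w f -> len (adj_swap n f * w)%g = (len w).+1.
Proof.
move=> a; have fn : f.+1 < n by case/andP: a.
have fn' := ltnW fn.
have ne : Ordinal fn != Ordinal fn' by rewrite -val_eqE /= neq_ltn ltnSn orbT.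
rewrite /len (bigD1 (Ordinal fn')) //= (bigD1 (Ordinal fn)) //=.
rewrite [in RHS](bigD1 (Ordinal fn')) //= [in RHS](bigD1 (Ordinal fn)) //=.
rewrite code_swap_left // code_swap_right // addSn addnCA; congr (_ + (_ + _)).+1.
by apply: eq_bigr => i /andP[i1 i2]; rewrite code_swap_other.
Qed.

Lemma run_len (D : {fset box}) bs w w' : run D w bs = Some w' ->
  len w' = len w + count (mem D) bs.
Proof.
elim: bs w => [|b bs IH] w /=; first by case=> ->; rewrite addn0.
case: ifP => _; last by move/IH.
by case: ifP => // a /IH ->; rewrite len_swap // addSnnS.
Qed.

Lemma maximal_code_val w : (forall i, i < n -> code w i = n - i.+1) ->
  forall i, i < n -> val_at w i = n - i.+1.
Proof.
move=> cw; have dec i : i.+1 < n -> val_at w i.+1 < val_at w i.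
  move=> iN; have na : ~~ asc w i.
    apply/negP => a; have := code_max (adj_swap n i * w)%g i.+1.
    by rewrite code_swap_right // cw; lia.
  move: na; rewrite /asc iN /= -leqNgt leq_eqVlt => /orP[/eqP /val_at_inj|//]; lia.
have up i : i < n -> val_at w i + i < n.
  elim: i => [|i IH] iN; first by rewrite addn0 val_at_lt.
  by have := dec i iN; have := IH (ltnW iN); lia.
have lo d i : i + d = n.-1 -> d <= val_at w i.
  elim: d i => // d IH i e; have := dec i ltac:(lia); have := IH i.+1 ltac:(lia); lia.
by move=> i iN; have := up i iN; have := lo (n - i.+1) i; lia.
Qed.

End LehmerCode.

(** * The determinantal formula for flag codes *)

Section SchubertFlag.

Variables (R : comNzRingType) (n : nat).
Implicit Types (x : nat -> R) (w : 'S_n).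

(** Allows divided difference identities to be cancelled in a ring that is not known to be a
    domain. *)
Definition generic x := forall i j, i != j -> GRing.lreg (x i - x j)%R.

Lemma generic_swap x f : generic x -> generic (swap_vars f x).
Proof.
move=> gx i j ij; apply: gx; apply: contra ij => /eqP e.
by rewrite -(swap_natK f i) e swap_natK.
Qed.

(* The coefficient of the longest permutation; it is only shown to be 1 at    *)
(* the end, by comparison with the identity permutation.                      *)
Definition top_coef : R :=
  if run (staircase n) (1%g : 'S_n) (boxes n) is Some v
  then ([forall i : 'I_n, code v i == (n - i.+1)%N]%:R)%R else 0%R.

Lemma size_boxes : size (boxes n) = \sum_(i < n) (n - i.+1).
Proof.
rewrite size_allpairs_dep sumnE big_map -{1}[n]subn0 big_mkord.
by apply: eq_bigr => i _; rewrite size_rev size_iota; lia.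
Qed.

Lemma big_boxes (F : box -> R) :
  (\prod_(b <- staircase n) F b = \prod_(b <- boxes n) F b)%R.
Proof.
apply: perm_big; apply: uniq_perm; rewrite ?fset_uniq ?boxes_uniq //.
by move=> b; rewrite staircaseE inE.
Qed.

(** The length of [w] is the number of boxes, so the full staircase is the only candidate for
    [D]. *)
Lemma word_sum_longest x w : (forall i, i < n -> code w i = n - i.+1) ->
  word_sum x w = (top_coef * \prod_(i < n) x i ^+ code w i)%R.
Proof.
move=> cw; have full D : D \in fpowerset (staircase n) ->
    run D 1%g (boxes n) == Some w -> D = staircase n.
  rewrite fpowersetE => /fsubsetP sD /eqP /run_len.
  have -> : len (1%g : 'S_n) = 0 by rewrite /len big1 // => i _; rewrite code1.
  rewrite (_ : len w = size (boxes n)); last first.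
    by rewrite size_boxes; apply: eq_bigr => i _; rewrite cw.
  rewrite add0n => /esym /eqP; rewrite -all_count => /allP aD.
  apply/fsetP => b; apply/idP/idP => [/sD //|].
  by rewrite staircaseE inE => /aD.
have top : top_coef = (run (staircase n) 1%g (boxes n) == Some w)%:R%R.
  rewrite /top_coef; case: run => [v|] //; congr (_%:R)%R; congr nat_of_bool.
  rewrite (inj_eq Some_inj); apply/forallP/eqP => [cv|-> i]; last by rewrite cw.
  apply: val_atP => i iN.
  rewrite !maximal_code_val // => j jN.
  by apply/eqP; apply: (cv (Ordinal jN)).
rewrite /word_sum big_mkcond (bigD1_seq (staircase n)) ?fset_uniq ?fpowersetE //=.
rewrite [X in (_ + X)%R]big_seq_cond [X in (_ + X)%R]big1 => [|D /andP[sD nD]]; last first.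
  by case: ifP => // /(full D sD) e; rewrite e eqxx in nD.
rewrite addr0 top; case: eqP => _; last by rewrite mul0r.
rewrite mul1r big_boxes big_allpairs_dep -{1}[n]subn0 big_mkord.
apply: eq_bigr => i _; rewrite cw //. rewrite /= big_const_seq count_predT size_rev size_iota.
by rewrite -iter_mulr_1; congr (iter _ _ _); lia.
Qed.

Lemma word_sum_id x : word_sum x (1%g : 'S_n) = 1%R.
Proof.
have none D : D \in fpowerset (staircase n) ->
    run D 1%g (boxes n) == Some (1%g : 'S_n) -> D = fset0.
  rewrite fpowersetE => /fsubsetP sD /eqP /run_len /eqP.
  rewrite -{1}[len _]addn0 eqn_add2l eq_sym -leqn0 leqNgt -has_count => /hasPn no.
  apply/fsetP => b; rewrite inE; apply/negP => bD.
  by have := sD b bD; rewrite staircaseE inE => /no /negP; apply.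
rewrite /word_sum big_mkcond (bigD1_seq fset0) ?fset_uniq ?fpowersetE ?fsub0set //=.
rewrite [X in (_ + X)%R]big_seq_cond [X in (_ + X)%R]big1 => [|D /andP[sD nD]]; last first.
  by case: ifP => // /(none D sD) e; rewrite e eqxx in nD.
rewrite addr0 big_seq_fset0 ifT //.
by elim: (boxes n) => //= b bs.
Qed.

Lemma word_sum_dominant x w : generic x ->
  (forall i, i.+1 < n -> code w i.+1 <= code w i) ->
  word_sum x w = (top_coef * \prod_(i < n) x i ^+ code w i)%R.
Proof.
have [N] := ubnP (n * n - len w).
elim: N w x => // N IH w x wN gx dec.
have [/forallP top|/forallPn /= [g cg]] := boolP [forall i : 'I_n, code w i == n - i.+1].
  by apply: word_sum_longest => i iN; apply/eqP/(top (Ordinal iN)).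
(* Raising the code at such an [f] is a swap to a longer permutation. For the smallest [f] its code
   is still weakly decreasing, since an equal entry at [f.-1] would be [ok] as well. *)
pose ok f := [&& f.+1 < n, code w f == code w f.+1 & code w f < n - f.+1].
have ex : exists f, ok f.
  have lt i : i < n -> code w i != n - i.+1 -> code w i < n - i.+1.
    by move=> iN ci; rewrite ltn_neqAle ci code_max.
  have [d] := ubnP (n - g); elim: d g cg => // d IHd g cg gd.
  have := lt g (ltn_ord g) cg => cg'; have gn : g.+1 < n by lia.
  have [e|ne] := eqVneq (code w g.+1) (n - g.+2); last first.
    by apply: (IHd (Ordinal gn)) => //=; lia.
  by exists g; rewrite /ok gn cg' eqn_leq dec // andbT e; lia.
case: (ex_minnP ex) => f /and3P[fn /eqP ef cf] fmin.
have af : asc w f.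
  by apply: contraT => /(code_desc fn); rewrite ef ltnn.
set w' := (adj_swap n f * w)%g.
have c1 : code w' f = (code w f.+1).+1 by apply: code_swap_left.
have c2 : code w' f.+1 = code w f by apply: code_swap_right.
have c3 i : i != f -> i != f.+1 -> code w' i = code w i by move=> *; apply: code_swap_other.
have dec' i : i.+1 < n -> code w' i.+1 <= code w' i.
  move=> iN; have di := dec i iN.
  have [e|i1] := eqVneq i f; first by rewrite e c1 c2; lia.
  have [e|i2] := eqVneq i f.+1.
    by rewrite e c2 c3 ?ef -?e //; apply/eqP; lia.
  have [e|i3] := eqVneq i.+1 f; last by rewrite !c3.
  by rewrite e in di; have := fmin i; rewrite /ok e (ltnW fn) c1 c3 //; lia.
have lenw := len_swap af; rewrite -/w' in lenw.
have len_max : len w' <= n * n.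
  apply: (@leq_trans (\sum_(i < n) n)); last by rewrite sum_nat_const card_ord.
  apply: leq_sum => i _.
  by apply: leq_trans (code_max _ _) _; lia.
have S' y : generic y -> word_sum y w' = (top_coef * \prod_(i < n) y i ^+ code w' i)%R.
  by move=> gy; apply: IH => //; lia.
have nf : f != f.+1 by rewrite neq_ltn ltnSn.
apply: (gx _ _ nf); rewrite -word_sum_divdiff // -/w' !S' //; last exact: generic_swap.
have fn' := ltnW fn.
have ne : Ordinal fn != Ordinal fn' by rewrite -val_eqE /= eq_sym.
have split (y : nat -> R) (c : nat -> nat) : (\prod_(i < n) y i ^+ c i = y f ^+ c f * (y f.+1 ^+ c f.+1 *
    \prod_(i < n | (i != Ordinal fn') && (i != Ordinal fn)) y i ^+ c i))%R.
  by rewrite (bigD1 (Ordinal fn')) //= (bigD1 (Ordinal fn)).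
rewrite !(split _ (code _)) c1 c2 ef !swap_vars_at.
have eQ (y : nat -> R) : (forall i, i != f -> i != f.+1 -> y i = x i) -> 
    (\prod_(i < n | (i != Ordinal fn') && (i != Ordinal fn)) y i ^+ code w' i =
     \prod_(i < n | (i != Ordinal fn') && (i != Ordinal fn)) x i ^+ code w i)%R.
  by move=> ey; apply: eq_bigr => i; rewrite -!val_eqE /= => /andP[i1 i2]; rewrite ey ?c3.
rewrite eQ // eQ; last first.
  by move=> i /negbTE i1 /negbTE i2; rewrite /swap_vars /swap_nat i1 i2.
by rewrite !exprS; ring.
Qed.

Lemma top_coefE x : generic x -> top_coef = 1%R.
Proof.
move=> gx; rewrite -(word_sum_id x) word_sum_dominant //; last first.
  by move=> i _; rewrite !code1.
by rewrite big1 ?mulr1 // => i _; rewrite code1.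
Qed.

(** Moving an entry left by one raises [mu] and lowers [phi] by one, so [mu + phi] and the second
    condition persist; once [phi i = i], that condition says that [mu] is weakly decreasing. *)
Definition has_flag_code w L (mu phi : nat -> nat) : Prop :=
  [/\ forall i, i.+1 < L -> phi i < phi i.+1,
      forall i, i.+1 < L -> mu i.+1 + phi i.+1 <= (mu i + phi i).+1,
      forall i, i < L -> phi i < n,
      forall i, i < L -> code w (phi i) = mu i &
      forall p, p < n -> (forall i, i < L -> phi i != p) -> code w p = 0].

Lemma has_flag_code_swap w L mu phi t f : has_flag_code w L mu phi ->
  t < L -> phi t = f.+1 -> (forall i, i < L -> phi i != f) ->
  asc w f /\ has_flag_code (adj_swap n f * w)%g L
    (upd mu t (mu t).+1) (upd phi t f).
Proof.
case=> inc dec phin cw c0 tL pt nf.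
have incr i j : i < j -> j < L -> phi i < phi j.
  elim: j => // j IHj; rewrite ltnS leq_eqVlt => /orP[/eqP->|ij] jL; first exact: inc.
  exact: ltn_trans (IHj ij (ltnW jL)) (inc j jL).
have inj i j : i < L -> j < L -> phi i = phi j -> i = j.
  by move=> iL jL; case: (ltngtP i j) => // /incr; [move=> /(_ jL)|move=> /(_ iL)]; lia.
have fn : f.+1 < n by rewrite -pt phin.
have cf : code w f = 0 by apply: c0 => //; apply: ltnW.
have af : asc w f by apply: contraT => /(code_desc fn); rewrite cf.
split=> //; split.
- move=> i iL; have := inc i iL; rewrite /upd.
  case: (i.+1 =P t) => [e'|it']; case: (i =P t) => [e|it] //; try lia.
    by rewrite e' pt => lt; have := nf i (ltnW iL); lia.
  by rewrite e pt; lia.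
- move=> i iL; have := dec i iL; rewrite /upd.
  case: (i.+1 =P t) => [e'|it']; case: (i =P t) => [e|it] //; try lia.
    by rewrite e' pt; lia.
  by rewrite e pt; lia.
- by move=> i iL; rewrite /upd; case: eqP => _; [lia|apply: phin].
- move=> i iL; rewrite /upd; case: eqP => [_|it].
    by rewrite code_swap_left // -pt cw.
  rewrite code_swap_other ?cw ?nf // -pt.
  by apply/eqP => /inj e; apply: it; apply: e.
- move=> p pn np; have [->|p1] := eqVneq p f.+1; first by rewrite code_swap_right.
  have p2 : p != f by have := np t tL; rewrite /upd eqxx eq_sym.
  rewrite code_swap_other //; apply: c0 => // i iL; have := np i iL.
  by rewrite /upd; case: (i =P t) => // -> _; rewrite pt eq_sym.
Qed.

Lemma word_sum_flag x w L mu phi : generic x -> has_flag_code w L mu phi ->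
  word_sum x w = flag_det x L (fun i => mu i + (L - i.+1)) (fun i => (phi i).+1).
Proof.
have [N] := ubnP (\sum_(i < L) phi i).
elim: N w x mu phi => // N IH w x mu phi pN gx hw.
pose movable (t : 'I_L) := (0 < phi t) && [forall i : 'I_L, phi i != (phi t).-1].
have [/existsP[t /andP[pt0 /forallP nf]]|stuck] := boolP [exists t, movable t].
  set f := (phi t).-1 in nf; have pt : phi t = f.+1 by rewrite prednK.
  have nf' i : i < L -> phi i != f by move=> iL; apply: (nf (Ordinal iL)).
  have [af hw'] := has_flag_code_swap hw (ltn_ord t) pt nf'.
  have nff : f != f.+1 by rewrite neq_ltn ltnSn.
  have sp := sum_upd (ltn_ord t) pt.
  have IH' y : generic y -> word_sum y (adj_swap n f * w)%g =
      flag_det y L (fun i => upd mu t (mu t).+1 i + (L - i.+1))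
        (fun i => (upd phi t f i).+1).
    by move=> gy; apply: IH => //; lia.
  apply: (gx _ _ nff); rewrite -word_sum_divdiff // !IH' //; last exact: generic_swap.
  rewrite (@flag_det_divdiff _ _ _ _ _ t (mu t + (L - t.+1)) f) //=.
  - congr (_ * _)%R; apply: eq_flag_det => i iL; rewrite /upd.
      by case: eqP => [->|] //.
    by case: eqP => [->|] //; rewrite pt.
  - by rewrite /upd eqxx addSn.
  - by rewrite /upd eqxx.
  - by move=> j jL jt; rewrite /upd (negbTE jt) eqSS nf'.
have [inc dec phin cw c0] := hw.
(* No entry has a free place to its left, so the increasing positions fill an initial segment and
   the code is dominant. *)
have phi_id i : i < L -> phi i = i.
  move=> iL; have incr k j : k <= j -> j < L -> phi k <= phi j.
    elim: j => [|j IHj]; first by rewrite leqn0 => /eqP->.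
    rewrite leq_eqVlt => /orP[/eqP-> //|kj] jL.
    exact: leq_trans (IHj kj (ltnW jL)) (ltnW (inc j jL)).
  elim: i iL => [|i IHi] iL.
    move/existsPn/(_ (Ordinal iL)): stuck; rewrite /movable /=.
    case: (posnP (phi 0)) => //= p0 /forallPn[j] /negPn /eqP e.
    by have := incr 0 j (leq0n _) (ltn_ord j); lia.
  have := inc i iL; rewrite IHi ?(ltnW iL) // => lt.
  move/existsPn/(_ (Ordinal iL)): stuck; rewrite /movable /=.
  rewrite (leq_trans _ lt) //= => /forallPn[j] /negPn /eqP e.
  case: (leqP i.+1 j) => [ij|ji]; first by have := incr _ _ ij (ltn_ord j); lia.
  have := incr j i; rewrite -ltnS ji IHi ?(ltnW iL) // => /(_ isT isT); lia.
have Ln : L <= n.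
  case: (L) phin phi_id => // L' phin phi_id.
  by have := phin L' (ltnSn _); rewrite phi_id.
have cwi i : i < n -> code w i = if i < L then mu i else 0.
  case: (ltnP i L) => [iL _|Li iN]; first by rewrite -{1}(phi_id i iL) cw.
  by apply: c0 => // j jL; rewrite phi_id //; lia.
have decw i : i.+1 < n -> code w i.+1 <= code w i.
  move=> iN; rewrite !cwi ?(ltnW iN) //; case: (ltnP i.+1 L) => // iL.
  have := dec i iL; rewrite (ltnW iL) (phi_id _ iL) (phi_id _ (ltnW iL)); lia.
rewrite word_sum_dominant // (top_coefE gx) mul1r.
rewrite (@eq_flag_det _ _ _ _ (fun i => mu i + (L - i.+1)) _ succn) //; last first.
  by move=> i iL; rewrite phi_id.
rewrite flag_det_dominant (big_ord_widen _ (fun i => x i ^+ mu i)%R Ln).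
rewrite [RHS]big_mkcond; apply: eq_bigr => i _; rewrite cwi //.
by case: ifP => // _; rewrite expr0.
Qed.

End SchubertFlag.

(** * The code of a permutation from its essential set *)

Section Diagram.

Variables (n : nat) (w : 'S_n).

Lemma mem_diagram p v :
  reflect (exists j, [/\ p < j, j < n, val_at w j = v & v < val_at w p])
          ((p, v) \in diagram w).
Proof.
apply: (iffP (imfsetP _ _ _ _)) => /= [[[i j]]|[j [pj jn <- lt]]].
  move=> /= /andP[ij wji] [-> ->].
  by exists j; rewrite !val_at_ord.
have pn := ltn_trans pj jn.
exists (Ordinal pn, Ordinal jn) => /=; last by rewrite (val_at_ord w (Ordinal jn)).
by move: lt; rewrite (val_at_ord w (Ordinal jn)) (val_at_ord w (Ordinal pn)) /= => lt; apply/andP.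
Qed.

Lemma rank_sum p q :
  rank_fun w p q = \sum_(i < n) ((i <= p) && (val_at w i <= q)).
Proof.
rewrite /rank_fun -sum1_card big_mkcond; apply: eq_bigr => i _.
by rewrite inE val_at_ord; case: (_ && _).
Qed.

Lemma rank_sum_nat p q : p < n ->
  rank_fun w p q = \sum_(0 <= i < p.+1) (val_at w i <= q).
Proof.
move=> pn; rewrite rank_sum big_mkord (big_ord_widen _ (fun i => nat_of_bool (val_at w i <= q)) pn).
rewrite [RHS]big_mkcond; apply: eq_bigr => i _; rewrite ltnS.
by case: (i <= p).
Qed.

Lemma rank_mono p q p' q' : p <= p' -> q <= q' -> rank_fun w p q <= rank_fun w p' q'.
Proof.
move=> pp qq; apply: subset_leq_card; apply/subsetP => i; rewrite !inE.
by case/andP => ip wq; rewrite (leq_trans ip) ?(leq_trans wq).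
Qed.

Lemma rank_strict i p q p' q' : p <= p' -> q <= q' -> i < n ->
  i <= p' -> val_at w i <= q' -> ~~ ((i <= p) && (val_at w i <= q)) ->
  rank_fun w p q < rank_fun w p' q'.
Proof.
move=> pp qq iN ip' wq' no; apply: proper_card; apply/properP; split.
  apply/subsetP => j; rewrite !inE.
  by case/andP => jp wq; rewrite (leq_trans jp) ?(leq_trans wq).
exists (Ordinal iN); rewrite inE /= -(val_at_ord w (Ordinal iN)) /=.
  by rewrite ip' wq'.
exact: no.
Qed.

Lemma sum_val_at_le q : q < n -> \sum_(i < n) (val_at w i <= q) = q.+1.
Proof.
move=> qn; transitivity (\sum_(i < n) (i <= q)).
  rewrite [RHS](reindex_inj (@perm_inj _ w)) /=.
  by apply: eq_bigr => i _; rewrite val_at_ord.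
transitivity (\sum_(i < q.+1) 1); last by rewrite sum_nat_const card_ord muln1.
rewrite (big_ord_widen n (fun=> 1) qn) [RHS]big_mkcond; apply: eq_bigr => i _.
by rewrite ltnS; case: (i <= q).
Qed.

(** Walk down or right inside the diagram until stuck. The rank stays constant: the new row has a
    larger value, and the value of the new column occurs in a later row. *)
Lemma diagram_essential p q : (p, q) \in diagram w ->
  exists p' q', [/\ essential w (p', q') (rank_fun w p q), p <= p' & q <= q'].
Proof.
have bound p' q' : (p', q') \in diagram w -> p' < n /\ q' < n.
  case/mem_diagram => j [pj jn <- _]; split; first exact: ltn_trans jn.
  by rewrite val_at_lt.
have [N] := ubnP (n - p + (n - q)); elim: N p q => // N IH p q lt pqD.
have [pn qn] := bound _ _ pqD.
case: (boolP ((p.+1, q) \in diagram w)) => [D1|D1].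
  have [|p' [q' [e pp qq]]] := IH p.+1 q _ D1; first by lia.
  exists p', q'; split=> //; last by lia.
  rewrite (_ : rank_fun w p q = rank_fun w p.+1 q) //.
  have [p1n _] := bound _ _ D1; case/mem_diagram: D1 => j [_ _ _ lt1].
  rewrite !rank_sum_nat // [RHS]big_nat_recr //=.
  by rewrite (leqNgt (val_at w p.+1)) lt1 addn0.
case: (boolP ((p, q.+1) \in diagram w)) => [D2|D2].
  have [|p' [q' [e pp qq]]] := IH p q.+1 _ D2; first by lia.
  exists p', q'; split=> //; last by lia.
  rewrite (_ : rank_fun w p q = rank_fun w p q.+1) //.
  case/mem_diagram: D2 => j [pj jn ej _].
  rewrite !rank_sum; apply: eq_bigr => i _; congr nat_of_bool.
  case: (leqP i p) => //= ip; rewrite [RHS]leq_eqVlt ltnS.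
  by case: eqP => //; rewrite -ej => /val_at_inj; lia.
by exists p, q; split.
Qed.

End Diagram.

(** * The Lehmer code forced by the corners of a stack *)

Section CodeFromEssentialSet.

(* Row i of the stack polyomino occupies the columns from B i to B i + W i - 1. *)
Variables (n k : nat) (w : 'S_n) (B W : nat -> nat).
Hypothesis nested : forall i, 0 < W i.+1 ->
  B i <= B i.+1 /\ B i.+1 + W i.+1 <= B i + W i.
Hypothesis bounded : exists h, forall i, h <= i -> W i = 0.

(** The bottom row of a maximal rectangle of height [i.+1] and width [W i], both larger than [k]. *)
Definition corner (i : nat) : Prop :=
  [/\ k <= i, k < W i & (B i.+1, W i.+1) <> (B i, W i)].

Hypothesis ess : forall x l, essential w x l <->
  exists i, [/\ corner i, x = (i + B i, (B i + W i).-1) & l = B i + k].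

Lemma width_mono i j : i <= j -> W j <= W i.
Proof.
elim: j => [|j IH]; first by rewrite leqn0 => /eqP->.
rewrite leq_eqVlt => /orP[/eqP-> //|ij]; apply: leq_trans (IH ij).
by case: (posnP (W j.+1)) => [->//|/nested]; lia.
Qed.

Lemma interval_mono i j : i <= j -> 0 < W j -> B i <= B j /\ B j + W j <= B i + W i.
Proof.
elim: j => [|j IH]; first by rewrite leqn0 => /eqP->.
rewrite leq_eqVlt => /orP[/eqP-> //|ij] Wj; have [b1 e1] := nested Wj.
by have := IH ij; have := width_mono (leqnSn j); lia.
Qed.

Lemma row_corner i : k <= i -> k < W i ->
  exists s, [/\ corner s, i <= s & forall j, i <= j <= s -> B j = B i /\ W j = W i].
Proof.
move=> ki Wi; have [h hW] := bounded.
have [d] := ubnP (h - i); elim: d i ki Wi => // d IH i ki Wi di.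
have [e|ne] := eqVneq (B i.+1, W i.+1) (B i, W i); last first.
  exists i; split=> //; first by split=> //; apply/eqP.
  by move=> j ij; have -> : j = i by lia.
case: e => eB eW; have ih : i < h by rewrite ltnNge; apply/negP => /hW; lia.
have [|||s [cs is_ same]] := IH i.+1; [by lia|by rewrite eW|by lia|].
exists s; split=> //; first by lia.
move=> j /andP[ij js]; have [-> //|ne] := eqVneq j i.
by rewrite -eB -eW; apply: same; lia.
Qed.

Lemma corner_essential s : corner s ->
  ((s + B s, (B s + W s).-1) \in diagram w) /\
  rank_fun w (s + B s) (B s + W s).-1 = B s + k.
Proof.
move=> cs; have [|D _ _ e] := (ess (s + B s, (B s + W s).-1) (B s + k)).2.
  by exists s.
by split.
Qed.

Lemma diagram_corner p q : (p, q) \in diagram w ->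
  exists s, [/\ corner s, p <= s + B s, q <= (B s + W s).-1 & rank_fun w p q = B s + k].
Proof.
move/diagram_essential => [p' [q' [/ess [s [cs [-> ->] e]] pp qq]]].
by exists s.
Qed.

Lemma corner_mono s s' : corner s -> corner s' -> s <= s' ->
  [/\ B s <= B s', B s' + W s' <= B s + W s & s + B s <= s' + B s'].
Proof.
move=> [_ _ _] [_ W' _] ss; have [|b e] := interval_mono ss; first by lia.
by split=> //; lia.
Qed.

Definition next_corner (p s : nat) : Prop :=
  [/\ corner s, p <= s + B s & forall s', corner s' -> p <= s' + B s' -> s <= s'].

Lemma next_corner_rank p s q : next_corner p s -> (p, q) \in diagram w ->
  B s + k <= rank_fun w p q /\ q <= (B s + W s).-1.
Proof.
move=> [cs ps least] /diagram_corner[s' [cs' ps' qs' ->]].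
by have [b e _] := corner_mono cs cs' (least _ cs' ps'); lia.
Qed.

Lemma code_gt0 p : 0 < code w p -> exists j, (p, val_at w j) \in diagram w /\ p < j < n.
Proof.
rewrite lt0n => c0; have [/existsP[j /andP[pj wj]]|no] :=
  boolP [exists j : 'I_n, (p < j) && (val_at w j < val_at w p)].
  by exists j; split; [apply/mem_diagram; exists j|rewrite pj /=].
case/eqP: c0; rewrite /code big1 // => j _.
by move/existsPn/(_ j)/negbTE: no => ->.
Qed.

(** The rank at the corner counts position [p], while the rank at a diagram box in row [p] does not;
    such a box would have rank below [B s + k], against [next_corner_rank]. *)
Lemma code_inside p s : next_corner p s -> val_at w p <= (B s + W s).-1 -> code w p = 0.
Proof.
move=> ns wp; apply/eqP; rewrite -leqn0 leqNgt; apply/negP => /code_gt0[j [D /andP[pj jn]]].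
have [r _] := next_corner_rank ns D; have [cs ps _] := ns.
have [_ rs] := corner_essential cs.
have lt : val_at w j < val_at w p by case/mem_diagram: D => ? [].
have := @rank_strict _ w p p (val_at w j) _ _ ps _ _ ps wp.
rewrite rs => h; move: r; rewrite leqNgt h //; try lia.
Qed.

Lemma no_later_small p s i : next_corner p s -> (B s + W s).-1 < val_at w p ->
  p < i <= s + B s -> (B s + W s).-1 < val_at w i.
Proof.
move=> ns wp /andP[pi is_]; rewrite ltnNge; apply/negP => wi.
have [cs ps _] := ns; have [Ds rs] := corner_essential cs.
have sn : s + B s < n by case/mem_diagram: Ds => j [pj jn _ _]; apply: ltn_trans jn.
have iN := leq_ltn_trans is_ sn.
have D : (p, val_at w i) \in diagram w.
  by apply/mem_diagram; exists i; split=> //; lia.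
have [r _] := next_corner_rank ns D.
have := @rank_strict _ w i p (val_at w i) _ _ ps wi iN is_ wi.
by rewrite leqNgt pi /= rs => /(_ isT); lia.
Qed.

Lemma rank_block p s : next_corner p s -> (B s + W s).-1 < val_at w p ->
  rank_fun w p (B s + W s).-1 = B s + k.
Proof.
move=> ns wp; have [cs ps _] := ns; have [Ds rs] := corner_essential cs.
have sn : s + B s < n by case/mem_diagram: Ds => j [pj jn _ _]; apply: ltn_trans jn.
rewrite -rs !rank_sum_nat //; last by lia.
rewrite [RHS](@big_cat_nat _ _ _ p.+1) //= [X in _ = _ + X]big1_seq ?addn0 // => i.
rewrite mem_index_iota => /andP[_ ip].
by rewrite leqNgt (@no_later_small p) //; lia.
Qed.

(** Of the [B s + W s] values up to the column of the corner, [B s + k] occur by position [p]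
    ([rank_block]). The others come later and are exactly the columns of the diagram boxes in row
    [p]. *)
Lemma code_outside p s : next_corner p s -> (B s + W s).-1 < val_at w p ->
  code w p = W s - k.
Proof.
move=> ns wp; have rp := rank_block ns wp; have [cs _ _] := ns.
have [Ds _] := corner_essential cs.
have Qn : (B s + W s).-1 < n.
  by case/mem_diagram: Ds => j [_ jn <- _]; rewrite val_at_lt.
have := sum_val_at_le w Qn.
rewrite (_ : \sum_(i < n) _ = code w p + rank_fun w p (B s + W s).-1).
  by rewrite rp; case: cs => _; lia.
rewrite rank_sum -big_split /=; apply: eq_bigr => j _.
case: (leqP j p) => pj /=; first by case: (_ <= _).
rewrite addn0; congr nat_of_bool; apply/idP/idP => [le|lt]; first by lia.
have D : (p, val_at w j) \in diagram w by apply/mem_diagram; exists j.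
by have [] := next_corner_rank ns D.
Qed.

(* Rows row0 to s of the polyomino all have the interval of the corner s, and *)
(* p0 is the row of the diagram just below the preceding essential box.       *)
Definition block_start (s row0 p0 : nat) : Prop :=
  [/\ k <= row0 <= s, forall i, row0 <= i <= s -> B i = B s /\ W i = W s,
      forall i, k <= i -> (forall j, corner j -> i <= j -> s <= j) -> row0 <= i,
      \sum_(0 <= i < p0) (val_at w i <= (B s + W s).-1) + row0 = p0 + k &
      forall p, p0 <= p <= s + B s -> next_corner p s].

Lemma corner_block p s : next_corner p s ->
  exists row0 p0, block_start s row0 p0 /\ p0 <= p.
Proof.
move=> [cs ps least]; have [ks kW _] := cs.
pose cornerb i := [&& k <= i, k < W i & (B i.+1, W i.+1) != (B i, W i)].
have cornerP i : reflect (corner i) (cornerb i).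
  by apply: (iffP and3P) => [[? ? /eqP ?]|[? ? /eqP ?]]; split.
have same i : k <= i <= s -> (forall j, corner j -> i <= j -> s <= j) ->
    B i = B s /\ W i = W s.
  case/andP=> ki is_ min; have Wi : k < W i by apply: leq_trans (width_mono is_).
  have [s1 [c1 i1 eq1]] := row_corner ki Wi.
  by have [|-> ->] := eq1 s => //; rewrite is_ min.
have [|none] := boolP [exists i : 'I_s, cornerb i]; last first.
  have first j : corner j -> s <= j.
    move=> /cornerP cj; rewrite leqNgt; apply: contra none => js.
    by apply/existsP; exists (Ordinal js).
  exists k, 0; split=> //; split=> //; first by rewrite leqnn.
  - by move=> i ki; apply: same => // j cj _; apply: first.
  - by rewrite big_geq // add0n.
  - by move=> p' /andP[_ p's]; split=> // s' cs' _; apply: first.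
case/existsP=> [[i0 i0s] /= ci0].
have ex : exists i, (i < s) && cornerb i by exists i0; rewrite i0s.
have bd i : (i < s) && cornerb i -> i <= s by case/andP => /ltnW.
case: (ex_maxnP ex bd) => s0 /andP[s0s /cornerP c0] max0 {i0 i0s ci0 ex bd}.
have above j : corner j -> s0 < j -> s <= j.
  move=> /cornerP cj s0j; rewrite leqNgt; apply/negP => js.
  by have := max0 j; rewrite js cj => /(_ isT); lia.
have [b0 e0 p0] := corner_mono c0 cs (ltnW s0s).
have [D0 r0] := corner_essential c0; have [Ds rs] := corner_essential cs.
have sn : s + B s < n by case/mem_diagram: Ds => j [pj jn _ _]; apply: ltn_trans jn.
have p0p : s0 + B s0 < p.
  by rewrite ltnNge; apply/negP => /(least _ c0); lia.
exists s0.+1, (s0 + B s0).+1; split=> //; split.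
- by case: c0; lia.
- move=> i /andP[s0i is_]; apply: same; first by case: c0; lia.
  by move=> j cj ij; apply: above => //; lia.
- move=> i ki min; rewrite ltnNge; apply/negP => /(min _ c0); lia.
(* The number of small values before [p0] is [B s0 + k]: at most that by monotonicity of the rank,
   and at least that because this box lies in the diagram, so its rank is that of a corner at or
   below [s0 + B s0]. *)
- have D : (s0 + B s0, (B s + W s).-1) \in diagram w.
    case/mem_diagram: Ds => j [pj jn ej _]; apply/mem_diagram; exists j.
    by split=> //; [lia|case/mem_diagram: D0 => j' [_ _ _]; lia].
  rewrite -rank_sum_nat; last by lia.
  have [s' [cs' ps' _ er]] := diagram_corner D.
  have le1 := @rank_mono _ w (s0 + B s0) (B s + W s).-1 (s0 + B s0) (B s0 + W s0).-1
    (leqnn _) ltac:(lia).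
  rewrite r0 in le1.
  have le2 : B s0 <= B s'.
    case: (leqP s0 s') => ss; first by have [] := corner_mono c0 cs' ss.
    have [? ? ?] := corner_mono cs' c0 (ltnW ss); lia.
  by lia.
- move=> p' /andP[p0p' p's]; split=> // s' cs' ps'; apply: above => //.
  by rewrite ltnNge; apply/negP => ss; have [_ _] := corner_mono cs' c0 ss; lia.
Qed.

(** Within the block all small values precede all large ones by [no_later_small], and the rank at
    the corner leaves [row0 + B s - p0] small ones. *)
Lemma small_position p s row0 p0 : block_start s row0 p0 -> p0 <= p <= s + B s ->
  (val_at w p <= (B s + W s).-1) = (p < row0 + B s).
Proof.
move=> [/andP[k0 r0s] same _ cnt nx] pp; have ns := nx p pp.
case/andP: pp => p0p ps; have [cs _ _] := ns.
have [Ds rs] := corner_essential cs.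
have sn : s + B s < n by case/mem_diagram: Ds => j [pj jn _ _]; apply: ltn_trans jn.
have split_rank : rank_fun w p (B s + W s).-1 =
    \sum_(0 <= i < p0) (val_at w i <= (B s + W s).-1) +
    (\sum_(p0 <= i < p) (val_at w i <= (B s + W s).-1) +
     (val_at w p <= (B s + W s).-1)).
  rewrite rank_sum_nat; last by lia.
  by rewrite (@big_cat_nat _ _ _ p0) //= ?big_nat_recr //; lia.
case: (leqP (val_at w p) _) => wp; apply/esym.
  have small : \sum_(p0 <= i < p) (val_at w i <= (B s + W s).-1) = p - p0.
    rewrite -[RHS]muln1 -sum_nat_const_nat; apply: eq_big_nat => i /andP[p0i ip].
    case: (leqP (val_at w i) _) => // wi.
    have nsi : next_corner i s by apply: nx; lia.
    by have := no_later_small nsi wi (i := p); rewrite ip ps => /(_ isT); lia.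
  have := @rank_mono _ w p (B s + W s).-1 _ _ ps (leqnn _).
  by rewrite rs split_rank small wp; lia.
have le : \sum_(p0 <= i < p) (val_at w i <= (B s + W s).-1) <= p - p0.
  rewrite -[p - p0]muln1 -sum_nat_const_nat; apply: leq_sum => i _.
  exact: leq_b1.
by have := rank_block ns wp; rewrite split_rank leqNgt wp /=; lia.
Qed.

Lemma code_row i : k <= i -> k < W i -> code w (i + B i) = W i - k.
Proof.
move=> ki Wi; have [s [cs is_ same]] := row_corner ki Wi.
have [eB eW] := same s ltac:(lia).
have ns : next_corner (i + B i) s.
  split=> //; first by rewrite eB; lia.
  move=> s' cs' ps'; rewrite leqNgt; apply/negP => s's.
  have [ks' W' ne] := cs'; case: (ltnP s' i) => s'i.
    by have [b _] := interval_mono (ltnW s'i) ltac:(lia); lia.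
  have [e1 e2] := same s' ltac:(lia); have [e3 e4] := same s'.+1 ltac:(lia).
  by apply: ne; rewrite e1 e2 e3 e4.
have [row0 [p0 [bl p0i]]] := corner_block ns.
rewrite -eW; apply: code_outside => //; rewrite ltnNge (small_position bl); last first.
  by rewrite p0i eB; lia.
have [_ _ min _ _] := bl; rewrite -leqNgt eB leq_add2r; apply: min => // j cj ij.
have [_ _ least] := ns; apply: least => //.
by have [_ Wj _] := cj; have [b _] := interval_mono ij ltac:(lia); lia.
Qed.

Lemma code_other p : (forall i, k <= i -> k < W i -> i + B i != p) -> code w p = 0.
Proof.
move=> no; apply/eqP; rewrite -leqn0 leqNgt; apply/negP => c0.
have [j [/diagram_corner[s1 [c1 p1 _ _]] _]] := code_gt0 c0.
pose cornerb i := [&& k <= i, k < W i & (B i.+1, W i.+1) != (B i, W i)].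
have cornerP i : reflect (corner i) (cornerb i).
  by apply: (iffP and3P) => [[? ? /eqP ?]|[? ? /eqP ?]]; split.
have ex : exists s, cornerb s && (p <= s + B s).
  by exists s1; rewrite p1 andbT; apply/cornerP.
case: (ex_minnP ex) => s /andP[/cornerP cs ps] min.
have ns : next_corner p s.
  split=> // s' /cornerP cs' ps'; apply: min; by rewrite cs'.
have [row0 [p0 [bl p0p]]] := corner_block ns.
case: (leqP (val_at w p) (B s + W s).-1) => wp.
  by rewrite (code_inside ns wp) in c0.
have := small_position bl (p := p); rewrite p0p ps leqNgt wp => /(_ isT) /= /esym /negbT.
rewrite -leqNgt => le; have [/andP[kr rs] same _ _ _] := bl.
have [eB eW] := same (p - B s) ltac:(lia); have [_ kW _] := cs.
by have := no (p - B s) ltac:(lia); rewrite eB eW => /(_ kW); lia.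
Qed.

Lemma has_flag_code_essential T : (forall t, (t < T) = (k < W (t + k))) ->
  has_flag_code w T (fun t => W (t + k) - k) (fun t => t + k + B (t + k)).
Proof.
move=> hT; have step t : t.+1 < T -> 
    [/\ B (t + k) <= B (t.+1 + k), B (t.+1 + k) + W (t.+1 + k) <= B (t + k) + W (t + k)
      & k < W (t.+1 + k)].
  rewrite hT => kW; have [||b e] := @interval_mono (t + k) (t.+1 + k); try lia.
  by split.
split.
- by move=> t /step [b _ _]; lia.
- by move=> t /step [b e kW]; lia.
- move=> t; rewrite hT => kW.
  have [|s [cs ts same]] := row_corner _ kW; first by lia.
  have [Ds _] := corner_essential cs; have [eB _] := same s ltac:(lia).
  by case/mem_diagram: Ds => j [pj jn _ _]; lia.
- by move=> t; rewrite hT => kW; apply: code_row => //; lia.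
- move=> p _ no; apply: code_other => i ki kW.
  by have := no (i - k); rewrite hT subnK // => /(_ kW).
Qed.

End CodeFromEssentialSet.

(** * Stack polyominoes *)

(** Nesting is asked for nonempty rows [i.+1] only, because the start of an empty row is
    arbitrary. *)
Definition rows_of (M : {fset box}) (B W : nat -> nat) : Prop :=
  [/\ forall r c, ((r, c) \in M) = (B r <= c < B r + W r),
      forall i, 0 < W i.+1 -> B i <= B i.+1 /\ B i.+1 + W i.+1 <= B i + W i &
      exists h, forall i, h <= i -> W i = 0].

Lemma mem_rectangle nw se (r c : nat) :
  ((r, c) \in rectangle nw se) = (nw.1 <= r <= se.1) && (nw.2 <= c <= se.2).
Proof.
apply/imfset2P/idP => /= [[r' + [c' + [-> ->]]]|].
  by rewrite ?inE /= ?mem_iota; lia.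
case/andP=> h1 h2; exists r; first by rewrite ?inE /= ?mem_iota; lia.
by exists c; rewrite // ?inE /= ?mem_iota; lia.
Qed.

(** All rows above row [i] contain its interval, so a maximal rectangle reaches the top and fills
    row [i]; it cannot be extended downwards exactly when the next row differs. *)
Lemma maximal_rectangle_rows M B W a b i j : rows_of M B W ->
  maximal_rectangle M (a, b) (i, j) <->
  [/\ a = 0, 0 < W i, b = B i, j = (B i + W i).-1 & (B i.+1, W i.+1) <> (B i, W i)].
Proof.
case=> memM nest _; have mono := interval_mono nest.
have sub i' b' j' : B i' <= b' -> j' < B i' + W i' -> b' <= j' ->
    rectangle (0, b') (i', j') `<=` M.
  move=> bb jj bj; apply/fsubsetP => -[r c]; rewrite mem_rectangle /= memM.
  case/andP=> ri /andP[bc cj]; have [] := mono r i' ri; lia.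
split=> [[/= ai bj /fsubsetP RM maxR]|[-> Wi -> -> ne]].
  have := RM (i, b); have := RM (i, j).
  rewrite !mem_rectangle !memM /= !leqnn ai bj /= => /(_ isT) h1 /(_ isT) h2.
  have Wi : 0 < W i by lia.
  have incl i' b' j' : i <= i' -> b' <= b -> j <= j' ->
      rectangle (a, b) (i, j) `<=` rectangle (0, b') (i', j').
    move=> ii bb jj; apply/fsubsetP => -[r c]; rewrite !mem_rectangle /=; lia.
  have e1 : rectangle (0, B i) (i, (B i + W i).-1) = rectangle (a, b) (i, j).
    by apply: maxR; [apply: incl; lia|apply: sub; lia].
  have := mem_rectangle (a, b) (i, j) 0 (B i); rewrite -e1 mem_rectangle /=.
  have := mem_rectangle (a, b) (i, j) i (B i + W i).-1; rewrite -e1 mem_rectangle /=.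
  move=> h3 h4; split; try lia; case=> eB eW.
  have e2 : rectangle (0, B i) (i.+1, (B i + W i).-1) = rectangle (a, b) (i, j).
    by apply: maxR; [apply: incl; lia|apply: sub; lia].
  have := mem_rectangle (a, b) (i, j) i.+1 (B i); rewrite -e2 mem_rectangle /=.
  by lia.
split=> //=; [lia|by apply: sub; lia|].
move=> [a' b'] [i' j'] /fsubsetP RR /fsubsetP RM.
have := RR (0, B i); have := RR (i, (B i + W i).-1); rewrite !mem_rectangle /=.
move=> h1 h2.
have {h1 h2} [h1 h2] : (a' <= i <= i') && (b' <= (B i + W i).-1 <= j') /\ 
    (a' <= 0 <= i') && (b' <= B i <= j') by split; [apply: h1|apply: h2]; lia.
have := RM (i, b'); have := RM (i, j'); rewrite !mem_rectangle !memM /= => h3 h4.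
have {h3 h4} [h3 h4] : B i <= j' < B i + W i /\ B i <= b' < B i + W i.
  by split; [apply: h3|apply: h4]; lia.
suff -> : i' = i by congr (rectangle (_, _) (_, _)); lia.
apply/eqP; rewrite eqn_leq; apply/andP; split; last by lia.
rewrite leqNgt; apply/negP => ii; apply: ne.
have := RM (i.+1, B i); have := RM (i.+1, (B i + W i).-1).
rewrite !mem_rectangle !memM /= => h5 h6.
have {h5 h6} [h5 h6] : B i.+1 <= (B i + W i).-1 < B i.+1 + W i.+1 /\
    B i.+1 <= B i < B i.+1 + W i.+1 by split; [apply: h5|apply: h6]; lia.
by have [] := nest i; [lia|move=> ? ?; congr (_, _); lia].
Qed.

Lemma sigma_flag_code k M B W n (w : 'S_n) T : rows_of M B W -> is_sigma k M w ->
  (forall t, (t < T) = (k < W (t + k))) ->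
  has_flag_code w T (fun t => W (t + k) - k) (fun t => t + k + B (t + k)).
Proof.
move=> rM sg hT; have [_ nest bd] := rM.
apply: has_flag_code_essential => // x l; split.
  case/sg => a [b [i [j [/(maximal_rectangle_rows _ _ _ _ rM)[-> Wi -> -> ne] h1 h2 -> ->]]]].
  by exists i; split; [split=> //; lia|rewrite addn0|].
case=> i [[ki kW ne] -> ->]; apply/sg; exists 0, (B i), i, (B i + W i).-1.
split; [|lia|lia|by rewrite addn0|by []].
by apply/(maximal_rectangle_rows _ _ _ _ rM); split=> //; lia.
Qed.

Lemma convex_pred_interval (P : pred nat) N :
  (forall c, P c -> c < N) ->
  (forall c1 c c2, c1 <= c <= c2 -> P c1 -> P c2 -> P c) ->
  forall c, P c = (find P (iota 0 N) <= c < find P (iota 0 N) + count P (iota 0 N)).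
Proof.
move=> PN conv c; have [hP|noP] := boolP (has P (iota 0 N)); last first.
  have -> : count P (iota 0 N) = 0 by apply/eqP; rewrite -leqn0 leqNgt -has_count.
  rewrite addn0; apply/idP/idP => [Pc|]; last by lia.
  by case/hasP: noP; exists c => //; rewrite mem_iota PN.
have fN : find P (iota 0 N) < N by rewrite -[X in _ < X](size_iota 0) -has_find.
have Pf : P (find P (iota 0 N)) by have := nth_find 0 hP; rewrite nth_iota.
have minf c' : P c' -> find P (iota 0 N) <= c'.
  move=> Pc'; rewrite leqNgt; apply/negP => lt; have := before_find 0 lt.
  by rewrite nth_iota ?add0n ?Pc' //; apply: ltn_trans fN.
set b := find P _ in fN Pf minf *.
have ub c' : P c' -> c' <= N by move/PN/ltnW.
case: (ex_maxnP (ex_intro _ b Pf) ub) => e Pe maxe.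
have Pin c' : P c' = (b <= c' <= e).
  apply/idP/idP => [Pc'|bce]; first by rewrite minf ?maxe.
  exact: conv bce Pf Pe.
have be := minf e Pe; have eN := PN e Pe.
rewrite Pin (_ : count P _ = e.+1 - b); first by lia.
rewrite (_ : iota 0 N = iota 0 b ++ iota b (e.+1 - b) ++ iota e.+1 (N - e.+1)).
  rewrite !count_cat.
  have c0 m d : (forall c', m <= c' < m + d -> ~~ P c') -> count P (iota m d) = 0.
    move=> no; apply/eqP; rewrite -leqn0 leqNgt -has_count; apply/hasPn => c'.
    by rewrite mem_iota => /no.
  rewrite (c0 0) ?(c0 e.+1) ?add0n ?addn0 => [|c' h|c' h]; [|by rewrite Pin; lia..].
  rewrite -[RHS](size_iota b); apply/eqP; rewrite -all_count; apply/allP => c'.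
  by rewrite mem_iota Pin; lia.
rewrite -[in iota e.+1 _](_ : b + (e.+1 - b) = e.+1); last by lia.
by rewrite -iotaD -{2}[b]add0n -iotaD; congr iota; lia.
Qed.

(** * Rows of a stack and of its Ferrers shape *)

Section StackRows.

Variable S : {fset box}.
Hypothesis stackS : is_stack S.

Definition col_bound : nat := (\max_(x <- S) x.2).+1.
Definition row_start (r : nat) : nat := find (fun c => (r, c) \in S) (iota 0 col_bound).
Definition row_width (r : nat) : nat := count (fun c => (r, c) \in S) (iota 0 col_bound).

Lemma stack_up r r' c : r <= r' -> (r', c) \in S -> (r, c) \in S.
Proof.
move=> rr' h; have [[[_ cv] _ _ _] top] := stackS.
by apply: (cv c 0 r r'); rewrite ?rr' //; apply: top h.
Qed.

Lemma col_lt_bound r c : (r, c) \in S -> c < col_bound.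
Proof. by move=> h; rewrite ltnS (@leq_bigmax_seq _ _ predT (fun x : box => x.2) (r, c)). Qed.

Lemma row_width_bounded : exists h, forall i, h <= i -> row_width i = 0.
Proof.
exists (\max_(x <- S) x.1).+1 => i hi; apply/eqP; rewrite -leqn0 leqNgt -has_count.
apply/hasPn => c _; apply/negP => h.
by rewrite ltnNge (@leq_bigmax_seq _ _ predT (fun x : box => x.1) (i, c)) in hi.
Qed.

Lemma row_width_mono i : row_width i.+1 <= row_width i.
Proof. by apply: sub_count => c; apply: stack_up. Qed.

Lemma stack_rows : rows_of S row_start row_width.
Proof.
have mem r c : ((r, c) \in S) = (row_start r <= c < row_start r + row_width r).
  apply: (convex_pred_interval (P := fun c => (r, c) \in S)) => [c'|c1 c' c2 ccc h1 h2].
    exact: col_lt_bound.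
  by have [[[cv _] _ _ _] _] := stackS; apply: cv ccc h1 h2.
split=> //; last exact: row_width_bounded.
move=> i W0; have := mem i.+1 (row_start i.+1); have := mem i.+1 (row_start i.+1 + row_width i.+1).-1.
rewrite !leqnn /= => h1 h2.
have {}h1 : (i.+1, (row_start i.+1 + row_width i.+1).-1) \in S by rewrite h1; lia.
have {}h2 : (i.+1, row_start i.+1) \in S by rewrite h2; lia.
by have := stack_up (leqnSn i) h1; have := stack_up (leqnSn i) h2; rewrite !mem; lia.
Qed.

Lemma col_length_gt i c : (i < col_length S c) = ((i, c) \in S).
Proof.
have sz m : #|` [fset ((r, c) : box) | r in iota 0 m] | = m.
  rewrite card_imfset /= ?undup_id ?iota_uniq ?size_iota // => r r'.
  by case.
apply/idP/idP => [|h]; last first.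
  rewrite -[X in X <= _]sz; apply: fsubset_leq_card; apply/fsubsetP => x.
  case/imfsetP => r rI ->; have : r \in iota 0 i.+1 := rI; rewrite mem_iota => ri.
  by rewrite !inE /= eqxx andbT; apply: stack_up h; lia.
apply: contraTT => h; rewrite -leqNgt.
rewrite -[X in _ <= X]sz; apply: fsubset_leq_card; apply/fsubsetP => -[r c'].
rewrite !inE /= => /andP[rS /eqP e]; apply/imfsetP; exists r => /=; last by rewrite -e.
rewrite mem_iota /= add0n ltnNge; apply: contra h => ir.
by apply: stack_up ir _; rewrite -e.
Qed.

Lemma sorted_geq_count (s : seq nat) i j : sorted geq s ->
  (j < size s) && (i < nth 0 s j) = (j < count (fun l => i < l) s).
Proof.
elim: s j => [|x s IH] j //= px.
case: (ltnP i x) => ix /=; first by case: j => [|j] /=; rewrite ?add1n ?ltnS ?IH ?(path_sorted px) ?ix.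
have all_le : all (fun l => l <= i) s.
  have tr : transitive geq by move=> a b c ba ca; apply: leq_trans ca ba.
  have := order_path_min tr px; apply: sub_all => l /= lx; exact: leq_trans ix.
have -> : count (fun l => i < l) s = 0.
  apply/eqP; rewrite -leqn0 leqNgt -has_count; apply/hasPn => l ls.
  by rewrite -leqNgt; apply: (allP all_le).
rewrite ltn0; case: j => [|j] /=; first by rewrite ltnNge ix.
apply/negP => /andP[js]; rewrite ltnNge; apply/negP/negPn.
by apply: (allP all_le); rewrite mem_nth.
Qed.

(** Row [i] of the Ferrers shape has one box for each column longer than [i]; in a stack these are
    the columns that meet row [i]. *)
Lemma mem_ferrers i j : ((i, j) \in ferrers_of S) = (j < row_width i).
Proof.
set s := sorted_col_lengths S.
have -> : ((i, j) \in ferrers_of S) = (j < size s) && (i < nth 0 s j).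
  apply/imfset2P/idP => /= [[j' + [i' + [-> ->]]]|/andP[h1 h2]].
    rewrite ?inE /= ?mem_iota /=. by rewrite !add0n => -> ->.
  by exists j; [rewrite mem_iota|exists i => //; rewrite mem_iota].
rewrite sorted_geq_count; last first.
  by apply: sort_sorted => a b; rewrite /= leq_total.
congr (_ < _); rewrite (seq.permP (permEl (perm_sort _ _))) count_map.
rewrite /row_width -!size_filter; apply: perm_size; apply: uniq_perm.
- by rewrite filter_uniq ?fset_uniq.
- by rewrite filter_uniq ?iota_uniq.
move=> c; rewrite !mem_filter mem_iota /= col_length_gt.
case h: ((i, c) \in S) => //=; rewrite (col_lt_bound h).
by apply/imfsetP; exists (i, c).
Qed.

Lemma ferrers_rows : rows_of (ferrers_of S) (fun=> 0) row_width.
Proof.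
split; last exact: row_width_bounded; first by move=> r c; rewrite mem_ferrers.
by move=> i _; have := row_width_mono i; lia.
Qed.

End StackRows.

(** * Polynomials in infinitely many variables *)

Lemma cmonom_mul_inj (m : {cmonom nat}) : injective (mulcm m).
Proof.
move=> m1 m2 e; apply/eqP/cmP => i; have := congr1 (fun m' : {cmonom nat} => m' i) e.
by rewrite !mulcmE => /addnI.
Qed.

Lemma mcoeff_xvarM i (f : ipoly) m :
  ((xvar i * f)@_m = \sum_(m' <- msupp f) f@_m' *+ (mulcm (ucm i) m' == m))%R.
Proof.
rewrite malgM_def fgmulUg raddf_sum /=; apply: eq_bigr => m' _.
by rewrite mul1r mcoeffU.
Qed.

Lemma mcoeff_xvarM_shift i (f : ipoly) m :
  ((xvar i * f)@_(mulcm (ucm i) m) = f@_m)%R.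
Proof.
rewrite mcoeff_xvarM (eq_bigr (fun m' => f@_m' *+ (m' == m))%R) => [|m' _]; last first.
  by rewrite (inj_eq (@cmonom_mul_inj _)).
have [mf|mf] := boolP (m \in msupp f).
  rewrite (bigD1_seq m) ?fset_uniq //= eqxx big1 ?addr0 // => m' /negbTE ->.
  by rewrite mulr0n.
rewrite mcoeff_outdom // big_seq big1 // => m' m'f; case: eqP => // e.
by rewrite -e m'f in mf.
Qed.

(* If x_i f = x_j f, then every monomial m of f comes with the monomial       *)
(* x_i m / x_j of f, whose exponent of x_i is larger.                         *)
Lemma generic_xvar : generic xvar.
Proof.
move=> i j ij; apply: mulrI0_lreg => f; rewrite mulrBl => /eqP; rewrite subr_eq0 => /eqP e.
apply/malgP => m0; rewrite mcoeff0; apply/eqP; apply: contraT => m0f.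
have unbounded d : exists2 m, m \in msupp f & d <= m i.
  elim: d => [|d [m mf dm]]; first by exists m0; rewrite ?mcoeff_neq0 in m0f *.
  have := mcoeff_xvarM_shift i f m; rewrite e mcoeff_xvarM => c.
  have [/hasP[m' m'f /eqP em]|no] :=
    boolP (has (fun m' => mulcm (ucm j) m' == mulcm (ucm i) m) (msupp f)).
    exists m'; first exact: m'f.
    have : mulcm (ucm j) m' i = mulcm (ucm i) m i by rewrite em.
    rewrite (mulcmE (ucm j)) (mulcmE (ucm i)) (ucmE j) (ucmE i) eqxx.
    by rewrite eq_sym (negbTE ij) add0n add1n => ->.
  move: c; rewrite big_seq big1 => [/esym/eqP|m' m'f].
    by rewrite mcoeff_eq0 mf.
  by move/hasPn/(_ _ m'f)/negbTE: no => ->.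
have [m mf] := unbounded (\max_(m <- msupp f) (m i)).+1.
by rewrite ltnNge (@leq_bigmax_seq _ _ predT (fun m : {cmonom nat} => m i) m).
Qed.

Lemma monomial_positive0 : monomial_positive 0%R.
Proof. by move=> m; rewrite mcoeff0. Qed.

Lemma monomial_positive1 : monomial_positive 1%R.
Proof. by move=> m; rewrite mcoeff1 ler0n. Qed.

Lemma monomial_positiveD f g :
  monomial_positive f -> monomial_positive g -> monomial_positive (f + g)%R.
Proof. by move=> pf pg m; rewrite mcoeffD addr_ge0 ?pf ?pg. Qed.

Lemma monomial_positive_xvarM i f :
  monomial_positive f -> monomial_positive (xvar i * f)%R.
Proof.
by move=> pf m; rewrite mcoeff_xvarM; apply: sumr_ge0 => m' _; rewrite mulrn_wge0 ?pf.
Qed.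

Theorem corollary1p6 (S : {fset box}) (k n m : nat)
    (sigma : 'S_n) (tau : 'S_m) :
  is_stack S -> 0 < k ->
  is_sigma k S sigma -> is_sigma k (ferrers_of S) tau ->
  monomial_positive (schubert sigma - schubert tau)%R.
Proof.
move=> stackS _ hs ht; set W := row_width S.
have rS := stack_rows stackS; have rF := ferrers_rows stackS.
have [_ nest [h hW]] := rS.
have Wmono i j : i <= j -> W j <= W i by apply: width_mono nest i j.
have ex : exists t, W (t + k) <= k by exists h; rewrite /W hW // leq_addr.
(* [T] is the number of rows of the common shape: [W] is weakly decreasing, so the rows [t + k]
   wider than [k] are those with [t < T]. *)
case: (ex_minnP ex) => T WT minT.
have hT t : (t < T) = (k < W (t + k)).
  apply/idP/idP => [tT|kW]; rewrite ltnNge; apply/negP => le.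
    by have := minT t le; rewrite leqNgt tT.
  have := leq_trans (Wmono (T + k) (t + k) _) WT; rewrite leq_add2r => /(_ le).
  by rewrite leqNgt kW.
have fs := sigma_flag_code rS hs hT; have ft := sigma_flag_code rF ht hT.
rewrite !schubert_word_sum (word_sum_flag generic_xvar fs) (word_sum_flag generic_xvar ft).
have [incs _ _ _ _] := fs; have [inct _ _ _ _] := ft.
apply: (flag_det_sub_pos monomial_positive0 monomial_positive1
  monomial_positiveD monomial_positive_xvarM) => i iT.
- have := Wmono (i + k) (i.+1 + k); rewrite leq_add2r leqnSn => /(_ isT).
  by rewrite -/W; lia.
- exact: ltnW (incs i iT).
- exact: ltnW (inct i iT).
- by lia.
Qed.
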